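(* Let $S$ be a finite non-empty set and $\Sigma\subseteq\mathbb{R}_+\times S$ locally finite, and let $(X_n,\eta_n)$ be a time-homogeneous irreducible Markov chain on $\Sigma$ such that every line $\Lambda_k=\{x\in\mathbb{R}_+:(x,k)\in\Sigma\}$, $k\in S$, is unbounded. Suppose that for some $p>2$ there is $C_p<\infty$ with $\mathbb{E}_{x,i}[|X_{n+1}-X_n|^p]\le C_p$ for all $(x,i)\in\Sigma$. Suppose that $q_{ij}(x)\to q_{ij}$ as $x\to\infty$ for all $i,j\in S$, where $(q_{ij})$ is an irreducible stochastic matrix with stationary distribution $\pi$. Suppose there exist $c_i\in\mathbb{R}$ and $s_i^2\ge0$, $i\in S$, with at least one $s_i^2\neq0$, such that $\mu_i(x)=\frac{c_i}{x}+o(x^{-1})$ and $\sigma_i^2(x)=s_i^2+o(1)$ as $x\to\infty$. If for some $\theta>0$ \[\sum_{i\in S}\left[2c_i+(2\theta-1)s_i^2\right]\pi_i<0,\] then for any $s\in[0,\theta\wedge\frac p2]$ we have $\mathbb{E}[\tau_x^s]<\infty$ for all $x$ sufficiently large.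
   Context: Locally finite means $\Sigma\cap([0,r]\times S)$ is finite for every $r\ge0$. Write $\mathbb{E}_{x,i}[\cdot]=\mathbb{E}[\cdot\mid X_n=x,\eta_n=i]$ and $\Pr_{x,i}$ similarly. Define $q_{ij}(x)=\Pr_{x,i}[\eta_{n+1}=j]$, $\mu_i(x)=\mathbb{E}_{x,i}[X_{n+1}-X_n]$, $\sigma_i^2(x)=\mathbb{E}_{x,i}[(X_{n+1}-X_n)^2]$. The stationary distribution $\pi=(\pi_i)_{i\in S}$ is the unique probability vector with $\pi_j=\sum_i\pi_iq_{ij}$. For $x\in\mathbb{R}_+$, $\tau_x=\min\{n\ge0: X_n\le x\}$. *)

(* Defs.v *)
From mathcomp Require Import all_boot all_order all_algebra.
From mathcomp Require Import all_classical all_reals all_analysis.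
Set Implicit Arguments. Unset Strict Implicit. Unset Printing Implicit Defensive.
Import Order.TTheory GRing.Theory Num.Theory numFieldNormedType.Exports.
Local Open Scope classical_set_scope.
Local Open Scope ring_scope.

(* A time-homogeneous Markov chain (X_n, eta_n) on a countable state space
   Sigma ⊆ R_+ × S is described by its transition probabilities
   P z w = Pr[(X_{n+1},eta_{n+1}) = w | (X_n,eta_n) = z]. *)

Section Defs.
Variables (R : realType) (S : finType).
Implicit Types (Sig : set (R * S)) (P : R * S -> R * S -> R).

Definition locally_finite_state_space Sig :=
  Sig `<=` [set z | 0 <= z.1] /\
  forall r : R, 0 <= r -> finite_set (Sig `&` [set z | z.1 <= r]).

Definition lines_unbounded Sig :=
  forall (k : S) (M : R), exists x : R, M <= x /\ Sig (x, k).

Definition markov_kernel Sig P :=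
  forall z, Sig z ->
    (forall w, 0 <= P z w) /\ (forall w, ~ Sig w -> P z w = 0) /\
    (\esum_(w in Sig) (P z w)%:E = 1)%E.

Inductive reachable Sig P : R * S -> R * S -> Prop :=
  | reach_refl z : reachable Sig P z z
  | reach_step z v w : Sig v -> 0 < P z v -> reachable Sig P v w ->
      reachable Sig P z w.

Definition irreducible_chain Sig P :=
  forall z w, Sig z -> Sig w -> reachable Sig P z w.

Definition kexp Sig P (z : R * S) (g : R * S -> R) : R :=
  fine (\esum_(w in Sig) (P z w * Num.max (g w) 0)%:E)%E
  - fine (\esum_(w in Sig) (P z w * Num.max (- g w) 0)%:E)%E.

Definition qx Sig P (i j : S) (x : R) : R :=
  fine (\esum_(w in Sig `&` [set w | w.2 = j]) (P (x, i) w)%:E)%E.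

Definition mu Sig P (i : S) (x : R) : R :=
  kexp Sig P (x, i) (fun w => w.1 - x).

Definition sigma2 Sig P (i : S) (x : R) : R :=
  kexp Sig P (x, i) (fun w => (w.1 - x) ^+ 2).

(* survival probability of tau_x = min{n >= 0 : X_n <= x}:
   surv x n z = Pr_z[tau_x > n] *)
Fixpoint surv Sig P (x : R) (n : nat) (z : R * S) : R :=
  match n with
  | 0 => ((x < z.1)%R : bool)%:R
  | m.+1 => if x < z.1 then
              fine (\esum_(w in Sig) (P z w * surv Sig P x m w)%:E)%E
            else 0
  end.

Definition tau_prob Sig P (x : R) (z : R * S) (n : nat) : R :=
  match n with
  | 0 => 1 - surv Sig P x 0 z
  | m.+1 => surv Sig P x m z - surv Sig P x m.+1 z
  end.

Definition tau_inf_prob Sig P (x : R) (z : R * S) : R :=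
  limn (fun n => surv Sig P x n z).

(* E_z[tau_x^s] in the extended reals (tau_x^s = +oo on {tau_x = +oo}) *)
Definition tau_moment Sig P (x s : R) (z : R * S) : \bar R :=
  (\esum_(n in [set: nat]) ((n%:R `^ s) * tau_prob Sig P x z n)%:E
   + (if (0 < tau_inf_prob Sig P x z)%R then +oo else 0))%E.

Definition stochastic (q : S -> S -> R) :=
  (forall i j, 0 <= q i j) /\ (forall i, \sum_j q i j = 1).

Definition irreducible_matrix (q : S -> S -> R) :=
  forall i j, connect [rel a b | 0 < q a b] i j.

Definition stationary_distribution (q : S -> S -> R) (pi : S -> R) :=
  (forall i, 0 <= pi i) /\ \sum_i pi i = 1 /\
  (forall j, pi j = \sum_i pi i * q i j).

End Defs.

(* Main.v *)
Require Import Defs.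
From mathcomp Require Import all_boot all_order all_algebra.
From mathcomp Require Import all_classical all_reals all_analysis.
From mathcomp Require Import ring lra.
Import Order.TTheory GRing.Theory Num.Theory numFieldNormedType.Exports.
Local Open Scope classical_set_scope.
Local Open Scope ring_scope.
Set Implicit Arguments. Unset Strict Implicit. Unset Printing Implicit Defensive.

(* Let g_i = 2 c_i + (2 t - 1) s_i^2 with sum_i g_i pi_i < 0.  The Poisson equation
   for q gives B >= 1 with g_i + sum_j q_ij B_j - B_i = - k < 0, and a second-order
   expansion shows that U(x, i) = x^2 + B_i satisfies, for large x,
     E [U_1^t] <= U_0^t - eps U_0^(t-1)                                        (D)
   whenever 2 t <= p: the contribution of jumps of order x is O(x^(2t-p)), which is
   negligible because p > 2.

   For t = s >= 1 the map v |-> (v^(1/s) + a)^s is concave, so (D) makes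
   (U_n + (eps/s) n)^s a supermartingale up to tau, which bounds E [tau^s].

   For s < 1 the strict inequality leaves room for some t in (s, 1).  While U < n
   the drift in (D) is at most - eps n^(t-1), hence tau > n forces either an
   excursion of U above n or about n steps of that drift; both have probability
   O(n^-t), and sum_n ((n+1)^s - n^s) n^-t is finite. *)

(** * Real powers *)

(** Bernoulli's inequality, read off from Young's inequality for the product [y * 1] with exponents
    [s] and [s / (s - 1)]; at [s = 1] the conjugate exponent degenerates. *)
Lemma powR_tangent1 (R : realType) (s y : R) : 1 <= s -> 0 <= y ->
  1 + s * (y - 1) <= y `^ s.
Proof.
rewrite le_eqVlt => /predU1P[<- y0|s1 y0]; first by rewrite powRr1//; lra.
have s0 : 0 < s by lra.
have h := @conjugate_powR R y 1 s (s / (s - 1)) y0 ler01 s0.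
have : y * 1 <= y `^ s / s + 1 `^ (s / (s - 1)) / (s / (s - 1)).
  apply: h; first by rewrite divr_gt0//; lra.
  by field; apply/andP; split; rewrite gt_eqF//; lra.
rewrite powR1 -(ler_pM2l s0) => h1.
have e : s * (y `^ s / s + 1 / (s / (s - 1))) = y `^ s + (s - 1).
  by field; apply/andP; split; rewrite gt_eqF//; lra.
by rewrite e in h1; lra.
Qed.

Lemma powR_tangent (R : realType) (s z y : R) : 1 <= s -> 0 < z -> 0 <= y ->
  z `^ s + s * z `^ (s - 1) * (y - z) <= y `^ s.
Proof.
move=> s1 z0 y0.
have yz : 0 <= y / z by rewrite divr_ge0// ltW.
have := powR_tangent1 s1 yz.
have zs : 0 < z `^ s by rewrite powR_gt0.
rewrite -(ler_pM2l zs) -powRM// ?(ltW z0)// [z * _]mulrC divfK ?gt_eqF//.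
apply: le_trans; rewrite le_eqVlt; apply/predU1P; left.
have -> : z `^ s = z * z `^ (s - 1) by rewrite mulr_powRB1// ?ltW//; lra.
by field; rewrite gt_eqF.
Qed.

(** Bernoulli's inequality with exponent 1/s, applied to y^s. *)
Lemma powR_concave1 (R : realType) (s y : R) : 0 < s -> s <= 1 -> 0 <= y ->
  y `^ s <= 1 + s * (y - 1).
Proof.
move=> s0 s1 y0.
have si : 1 <= s^-1 by rewrite invf_ge1.
have := powR_tangent1 si (powR_ge0 y s).
rewrite -powRrM divff ?gt_eqF// powRr1// -(ler_pM2l s0) mulrDr mulrA divff ?gt_eqF//.
lra.
Qed.

(** Average the tangent inequalities at the mean m = l t + (1 - l), evaluated at t and at 1: the
    slope terms cancel. The case l = 1 is split off because m may then vanish. *)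
Lemma powR_jensen (R : realType) (s l t : R) : 1 <= s -> 0 <= l -> l <= 1 -> 0 <= t ->
  (l * t + (1 - l)) `^ s <= l * t `^ s + (1 - l).
Proof.
move=> s1 l0 l1 t0.
have [->|ln1] := eqVneq l 1; first by rewrite subrr !mul1r !addr0.
have m0 : 0 < l * t + (1 - l).
  by rewrite ltr_wpDl// ?mulr_ge0// subr_gt0 lt_neqAle ln1.
have h1 := powR_tangent s1 m0 t0.
have h2 := powR_tangent s1 m0 ler01.
rewrite powR1 in h2.
set m := l * t + (1 - l) in m0 h1 h2 *.
have := lerD (ler_wpM2l l0 h1) (ler_wpM2l (_ : 0 <= 1 - l) h2).
rewrite subr_ge0 => /(_ l1).
set a := m `^ s; set b := m `^ (s - 1).
have -> : l * (a + s * b * (t - m)) + (1 - l) * (a + s * b * (1 - m)) = a by rewrite /m; ring.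
by rewrite mulr1.
Qed.

(* v |-> (v^(1/s) + a)^s is concave for s >= 1; this is its tangent inequality
   at v = U^s. *)
Lemma powR_shift_tangent (R : realType) (s a U U1 : R) :
  1 <= s -> 0 <= a -> 0 < U -> 0 <= U1 ->
  (U1 + a) `^ s <= (U + a) `^ s
    + (U + a) `^ (s - 1) * U `^ (1 - s) * (U1 `^ s - U `^ s).
Proof.
move=> s1 a0 U0 U10.
have Ua : 0 < U + a by lra.
have l0 : 0 <= U / (U + a) by rewrite divr_ge0// ltW.
have l1 : U / (U + a) <= 1 by rewrite ler_pdivrMr// mul1r; lra.
have t0 : 0 <= U1 / U by rewrite divr_ge0// ltW.
(* With weight U / (U + a), the mean of U1 / U and 1 is (U1 + a) / (U + a). *)
have := powR_jensen s1 l0 l1 t0.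
have k0 : 0 <= U / (U + a) * (U1 / U) + (1 - U / (U + a)).
  by apply: addr_ge0; [exact: mulr_ge0|rewrite subr_ge0].
rewrite -(ler_pM2l (powR_gt0 s Ua)) -powRM ?(ltW Ua)//.
have -> : (U + a) * (U / (U + a) * (U1 / U) + (1 - U / (U + a))) = U1 + a.
  by field; rewrite !gt_eqF.
move=> /le_trans; apply.
rewrite powRM// ?invr_ge0 ?(ltW U0)// -[U^-1]powR_inv1 ?(ltW U0)// -powRrM mulN1r.
have -> : U `^ (1 - s) = U * U `^ (- s) by rewrite powRD ?(gt_eqF U0) ?implybT// powRr1// ltW.
have -> : (U + a) `^ s = (U + a) * (U + a) `^ (s - 1).
  by rewrite mulr_powRB1//; lra.
have us : U `^ (- s) * U `^ s = 1 by rewrite powRN mulVf// gt_eqF// powR_gt0.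
rewrite le_eqVlt; apply/predU1P; left.
set x := (U + a) `^ (s - 1).
have -> : (U + a) * x + x * (U * U `^ (- s)) * (U1 `^ s - U `^ s) =
  (U + a) * x + x * U * (U `^ (- s) * U1 `^ s) - x * U * (U `^ (- s) * U `^ s) by ring.
by rewrite us; field; rewrite gt_eqF.
Qed.

Lemma powR_taylor1 (R : realType) (s e : R) : 0 < e ->
  exists d : R, [/\ 0 < d, d < 1 & forall h : R, `|h| <= d ->
    `|(1 + h) `^ s - 1 - s * h| <= e * `|h|].
Proof.
move=> e0.
have D := @is_derive1_powR R s 1 ltr01.
have [D1 D2] := D; rewrite powR1 mulr1 in D2.
have C : (fun h : R => h^-1 *: (((powR (R:=R))^~ s \o shift 1) (h *: (1:R)) - 1 `^ s)) @ 0^' --> s.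
  by rewrite -[X in _ --> X]D2; exact: D1.
move/cvgrPdist_le : C => /(_ e e0).
case=> d /= d0 H.
exists (Num.min (d / 2) (1/2)); split.
- by rewrite lt_min; apply/andP; split; lra.
- by rewrite gt_min; apply/orP; right; lra.
- move=> h; rewrite le_min => /andP[hd h2].
  have [->|hn0] := eqVneq h 0.
    by rewrite addr0 powR1 normr0 !mulr0 subrr subr0 normr0.
  have := H h; rewrite /= sub0r normrN => /(_ _ hn0).
  have hd' : `|h| < d by lra.
  move=> /(_ hd'); rewrite powR1 /= -(ler_pM2r (_ : 0 < `|h|)) ?normr_gt0// -normrM.
  rewrite mulrBl /GRing.scale/= mulr1 [h + 1]addrC.
  have -> : h^-1 * ((1 + h) `^ s - 1) * h = (1 + h) `^ s - 1 by field.
  by rewrite distrC.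
Qed.

(** The difference [f] of the two sides vanishes at 0, and its derivative [df] has the sign of x by
    the first-order expansion of (1 + x)^(s-1). The mean value theorem then gives f >= 0 on either
    side of 0. *)
Lemma powR_taylor2 (R : realType) (s e : R) : 0 < s -> 0 < e ->
  exists d : R, [/\ 0 < d, d < 1 & forall h : R, `|h| <= d ->
    (1 + h) `^ s <= 1 + s * h + (s * (s - 1) / 2 + e) * h ^+ 2].
Proof.
move=> s0 e0.
(* Multiplied by s, this tolerance becomes 2 e, the coefficient in the derivative of e h^2. *)
have es : 0 < 2 * e / s by rewrite divr_gt0//; lra.
have [d [d0 d1 H]] := @powR_taylor1 R (s - 1) _ es.
exists d; split => // h hd.
pose df (x : R) := s + (s * (s - 1) + 2 * e) * x - s * (1 + x) `^ (s - 1).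
pose f (x : R) := 1 + s * x + (s * (s - 1) / 2 + e) * x ^+ 2 - (1 + x) `^ s.
have fD (x : R) : `|x| <= d -> is_derive x 1 f (df x).
  move=> xd; have x1 : 0 < 1 + x.
    by have := ler_norm (- x); rewrite normrN; lra.
  have := @is_derive1_powR R s (1 + x) x1 => Dp.
  have Dg : is_derive x 1 (cst 1 + id : R -> R) (0 + 1) by exact: is_deriveD.
  have Dc : is_derive x 1 (fun x => (1 + x) `^ s) (s * (1 + x) `^ (s - 1)).
    by have := is_derive1_comp Dp Dg; rewrite add0r mulr1.
  rewrite /f; apply: is_derive_eq.
  have E (y : R) : (0 + 1) * (s * 1) + (s * (s - 1) / 2 + e) * (x * 1 + x * 1) - y =
    s + (s * (s - 1) + 2 * e) * x - y by field.
  exact: E.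
have sgn (x : R) : `|x| <= d -> 0 <= df x * x.
  move=> xd; have := H x xd; rewrite ler_norml => /andP[].
  rewrite /df.
  set g := (1 + x) `^ (s - 1) => A B.
  have K : s * (2 * e / s * `|x|) = 2 * e * `|x| by field; rewrite gt_eqF.
  have A' := ler_wpM2l (ltW s0) A; have B' := ler_wpM2l (ltW s0) B.
  rewrite mulrN !K in A' B'.
  have [x0|x0] := leP 0 x.
    by rewrite ger0_norm// in A' B'; apply: mulr_ge0 => //; lra.
  rewrite ltr0_norm// in A' B'; apply: mulr_le0; lra.
have f0 : f 0 = 0 by rewrite /f addr0 powR1; ring.
suff : 0 <= f h by rewrite /f; lra.
have [h0|h0] := leP 0 h.
  rewrite ger0_norm// in hd.
  have xx (x : R) : x \in `[0, h] -> `|x| <= d.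
    by rewrite in_itv/= => /andP[a b]; rewrite ger0_norm//; lra.
  have [||x xh] := @MVT_segment R f df 0 h h0.
  - by move=> x /subset_itv_oo_cc xh; apply: fD; apply: xx.
  - apply: derivable_within_continuous => x xh; by case: (fD x (xx x xh)).
  - rewrite f0 !subr0 => ->.
    have := sgn x (xx x xh); move: xh; rewrite in_itv/= => /andP[x0 xh].
    (* The intermediate point may be the endpoint 0, where the sign condition says nothing; there
       [df] vanishes. *)
    move: x0; rewrite le_eqVlt => /predU1P[<- _|x0]; last first.
      by rewrite pmulr_lge0// => ?; rewrite mulr_ge0.
    by rewrite /df addr0 powR1; apply: mulr_ge0 => //; lra.
rewrite ltr0_norm// in hd.
have xx (x : R) : x \in `[h, 0] -> `|x| <= d.
  by rewrite in_itv/= => /andP[a b]; rewrite ler0_norm//; lra.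
have [||x xh] := @MVT_segment R f df h 0 (ltW h0).
- by move=> x /subset_itv_oo_cc xh; apply: fD; apply: xx.
- apply: derivable_within_continuous => x xh; by case: (fD x (xx x xh)).
- rewrite f0 !sub0r => E.
  have := sgn x (xx x xh); move: xh; rewrite in_itv/= => /andP[xh x0].
  move: x0; rewrite le_eqVlt => /predU1P[x0 _|x0].
    by move: E; rewrite x0 /df addr0 powR1; lra.
  rewrite nmulr_lge0// => dx.
  have F : df x * - h <= 0 by apply: mulr_le0_ge0 => //; lra.
  by lra.
Qed.

(** Away from 0 a lower power is absorbed by a higher one: powers of a / d >= 1 increase with the
    exponent. *)
Lemma powR_le_far (R : realType) (d p q a : R) : 0 < d -> d <= a -> q <= p ->
  a `^ q <= d `^ q * d^-1 `^ p * a `^ p.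
Proof.
move=> d0 da qp.
have a0 : 0 <= a by rewrite (le_trans (ltW d0)).
have ad : 1 <= d^-1 * a by rewrite mulrC ler_pdivlMr// mul1r.
rewrite -mulrA -powRM ?invr_ge0 ?(ltW d0)//.
have {1}-> : a = d * (d^-1 * a) by rewrite mulVKf// gt_eqF.
rewrite powRM ?(ltW d0)//; last exact: le_trans ad.
by apply: ler_wpM2l; [exact: powR_ge0|exact: ler_powR].
Qed.

(** The first-order expansion at h = B u, uniform over B in [0, beta]; [beta + 1] avoids a division
    by zero. *)
Lemma powR_lower1 (R : realType) (s e beta : R) : 0 < e -> 0 <= beta ->
  exists2 u0 : R, 0 < u0 & forall u B : R, 0 <= u -> u <= u0 -> 0 <= B -> B <= beta ->
    1 + s * B * u - e * u <= (1 + B * u) `^ s.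
Proof.
move=> e0 b0; have b1 : 0 < beta + 1 by lra.
have [d [d0 d1 H]] := @powR_taylor1 R s _ (divr_gt0 e0 b1).
exists (d / (beta + 1)); first exact: divr_gt0.
move=> u B u0; rewrite ler_pdivlMr// => ud B0 Bb.
have Bu0 : 0 <= B * u by exact: mulr_ge0.
have Bu : B * u <= u * (beta + 1) by rewrite mulrC ler_wpM2l//; lra.
have := H (B * u); rewrite ger0_norm// => /(_ (le_trans Bu ud)).
rewrite ler_norml => /andP[h _].
have : e / (beta + 1) * (B * u) <= e * u.
  rewrite -mulrA ler_pM2l// mulrC ler_pdivrMr//.
by lra.
Qed.

(** With h = 2 r + r^2 + B u the base is 1 + h, and h^2 equals 4 r^2 up to small multiples of r^2
    and u. The coefficient of r^2 becomes s + 2 s (s - 1) = s (2 s - 1). *)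
Lemma powR_quad_near (R : realType) (s e beta : R) : 0 < s -> 0 < e -> 0 <= beta ->
  exists d u0 : R, [/\ 0 < d, 0 < u0 & forall r u B : R,
    `|r| <= d -> 0 <= u -> u <= u0 -> 0 <= B -> B <= beta ->
    ((1 + r) ^+ 2 + B * u) `^ s <=
    1 + 2 * s * r + s * (2 * s - 1) * r ^+ 2 + s * B * u + e * (r ^+ 2 + u)].
Proof.
move=> s0 e0 b0.
(* Multiplied by 4 r^2, this uses half of the allowance e r^2; the other half is left for h^2 - 4
   r^2. *)
have e80 : 0 < e / 8 by lra.
have [d1 [d10 d11 H]] := powR_taylor2 s0 e80.
set k := s * (s - 1) / 2 + e / 8 in H.
pose M := `|k| + 1; have M0 : 0 < M by rewrite /M; have := normr_ge0 k; lra.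
pose b := beta + 1; have bp : 0 < b by rewrite /b; lra.
(* The bounds on 6 d here and on 2 b u0 below keep |h| <= d1; those involving M make |k| times the
   error in h^2 at most (e/2) r^2 + e u. *)
have [d [d0 dd1 dM dMb d_1]] : exists d : R,
    [/\ 0 < d, 6 * d <= d1, 10 * M * d <= e, 12 * M * b * d <= e & d <= 1].
  exists (Num.min (d1 / 6) (Num.min (e / (10 * M)) (Num.min (e / (12 * M * b)) 1))).
  set D := Num.min _ _.
  have D1 : D <= d1 / 6 by rewrite /D ge_min lexx.
  have D2 : D <= e / (10 * M) by rewrite /D !ge_min lexx orbT.
  have D3 : D <= e / (12 * M * b) by rewrite /D !ge_min lexx !orbT.
  have D4 : D <= 1 by rewrite /D !ge_min lexx !orbT.
  have M12 : 0 < 12 * M * b by rewrite !mulr_gt0 ?ltr0n.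
  have M10 : 0 < 10 * M by rewrite mulr_gt0 ?ltr0n.
  split => //.
  - by rewrite /D !lt_min ltr01 !divr_gt0.
  - lra.
  - by move: D2; rewrite ler_pdivlMr// mulrC.
  - by move: D3; rewrite ler_pdivlMr// mulrC.
have [u0 [u00 ud1 uM]] : exists u0 : R,
    [/\ 0 < u0, 2 * b * u0 <= d1 & 2 * M * b ^+ 2 * u0 <= e].
  exists (Num.min (d1 / (2 * b)) (e / (2 * M * b ^+ 2))).
  set D := Num.min _ _.
  have D1 : D <= d1 / (2 * b) by rewrite /D ge_min lexx.
  have D2 : D <= e / (2 * M * b ^+ 2) by rewrite /D !ge_min lexx orbT.
  have M12 : 0 < 2 * M * b ^+ 2 by rewrite !mulr_gt0// exprn_gt0.
  have M10 : 0 < 2 * b by rewrite mulr_gt0.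
  split.
  - by rewrite /D !lt_min !divr_gt0.
  - by move: D1; rewrite ler_pdivlMr// mulrC.
  - by move: D2; rewrite ler_pdivlMr// mulrC.
exists d, u0; split => // r u B rd u_ge0 uu0 B0 Bb.
have Bu0 : 0 <= B * u by exact: mulr_ge0.
have Bub : B * u <= b * u by apply: ler_wpM2r => //; rewrite /b; lra.
have bu : b * u <= b * u0 by rewrite ler_pM2l.
have r2 : r ^+ 2 = `|r| ^+ 2 by rewrite real_normK// num_real.
have rr : r ^+ 2 <= `|r|.
  by rewrite r2 expr2 ler_piMr//; lra.
have r20 : 0 <= r ^+ 2 by exact: sqr_ge0.
set h := 2 * r + r ^+ 2 + B * u.
have -> : (1 + r) ^+ 2 + B * u = 1 + h by rewrite /h; ring.
have hd : `|h| <= d1.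
  rewrite /h; apply: (le_trans (ler_normD _ _)); rewrite (ger0_norm Bu0).
  have := ler_normD (2 * r) (r ^+ 2); rewrite normrM (ger0_norm r20) ger0_norm//.
  by lra.
apply: (le_trans (H h hd)).
have key : `|h ^+ 2 - 4 * r ^+ 2| <= 5 * d * r ^+ 2 + (6 * b * d + b ^+ 2 * u0) * u.
  have -> : h ^+ 2 - 4 * r ^+ 2 = r * (4 + r) * r ^+ 2 + (B * u) * (2 * (r * (2 + r)))
     + (B * u) * (B * u) by rewrite /h; ring.
  apply: (le_trans (ler_normD _ _)).
  have t1 : `|r * (4 + r) * r ^+ 2| <= 5 * d * r ^+ 2.
    rewrite normrM (ger0_norm r20); apply: ler_wpM2r => //.
    rewrite normrM mulrC; apply: ler_pM => //.
    by apply: (le_trans (ler_normD _ _)); rewrite ger0_norm//; lra.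
  have t2 : `|B * u * (2 * (r * (2 + r)))| <= 6 * b * d * u.
    rewrite normrM (ger0_norm Bu0).
    have -> : 6 * b * d * u = (b * u) * (2 * (d * 3)) by ring.
    apply: ler_pM => //.
    rewrite normrM ger0_norm// ler_pM2l// normrM; apply: ler_pM => //.
    by apply: (le_trans (ler_normD _ _)); rewrite ger0_norm//; lra.
  have t3 : B * u * (B * u) <= b ^+ 2 * u0 * u.
    have -> : b ^+ 2 * u0 * u = (b * u0) * (b * u) by ring.
    by apply: ler_pM => //; lra.
  rewrite (ger0_norm (mulr_ge0 Bu0 Bu0)).
  have := ler_normD (r * (4 + r) * r ^+ 2) (B * u * (2 * (r * (2 + r)))).
  by lra.
have kh : k * (h ^+ 2 - 4 * r ^+ 2) <= M * (5 * d * r ^+ 2 + (6 * b * d + b ^+ 2 * u0) * u).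
  apply: (le_trans (ler_norm _)); rewrite normrM; apply: ler_pM => //.
  by rewrite /M; lra.
have m1 : 10 * M * d * r ^+ 2 <= e * r ^+ 2 by exact: ler_wpM2r.
have m2 : 12 * M * b * d * u <= e * u by exact: ler_wpM2r.
have m3 : 2 * M * b ^+ 2 * u0 * u <= e * u by exact: ler_wpM2r.
have ek : k * h ^+ 2 = k * (h ^+ 2 - 4 * r ^+ 2) + 4 * k * r ^+ 2 by ring.
rewrite ek.
have E1 : 2 * (M * (5 * d * r ^+ 2 + (6 * b * d + b ^+ 2 * u0) * u)) =
  10 * M * d * r ^+ 2 + 12 * M * b * d * u + 2 * M * b ^+ 2 * u0 * u by ring.
have E2 : s * h + 4 * k * r ^+ 2 =
  2 * s * r + s * (2 * s - 1) * r ^+ 2 + s * B * u + e / 2 * r ^+ 2.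
  by rewrite /h /k; field.
by lra.
Qed.

(** For |r| <= d this is the local expansion. For |r| > d each term, including those on the right
    that may be negative, is at most a multiple of |r|^p, because 1, 2 and 2 s are all <= p. *)
Lemma powR_quad_bound (R : realType) (s p e beta : R) :
  0 < s -> 2 * s <= p -> 2 <= p -> 0 < e -> 0 <= beta ->
  exists C u0 : R, [/\ 0 <= C, 0 < u0 & forall r u B : R,
    0 <= u -> u <= u0 -> 0 <= B -> B <= beta ->
    ((1 + r) ^+ 2 + B * u) `^ s <=
    1 + 2 * s * r + s * (2 * s - 1) * r ^+ 2 + s * B * u + e * (r ^+ 2 + u)
    + C * `|r| `^ p].
Proof.
move=> s0 sp p2 e0 b0.
have [d [u1 [d0 u10 H]]] := powR_quad_near s0 e0 b0.
have bp : 0 < beta + 1 by lra.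
(* For |r| > d one has 1 <= |r| / d and B u <= 1, so (1 + r)^2 + B u <= K r^2. *)
pose K := (d^-1 + 1) ^+ 2 + d^-1 ^+ 2.
have di : 0 < d^-1 by rewrite invr_gt0.
have K0 : 0 <= K by rewrite /K addr_ge0// sqr_ge0.
pose cc q := d `^ q * d^-1 `^ p.
have cc0 q : 0 <= cc q by rewrite mulr_ge0 ?powR_ge0.
exists (K `^ s * cc (2 * s) + 2 * s * cc 1 + `|s * (2 * s - 1)| * cc 2),
  (Num.min u1 (beta + 1)^-1); split.
- by rewrite !addr_ge0 ?mulr_ge0 ?powR_ge0// ltW.
- by rewrite lt_min u10 invr_gt0.
move=> r u B u0; rewrite le_min => /andP[uu1 ub] B0 Bb.
have Bu0 : 0 <= B * u by exact: mulr_ge0.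
have [rd|rd] := leP `|r| d.
  apply: (le_trans (H r u B rd u0 uu1 B0 Bb)); rewrite lerDl mulr_ge0 ?powR_ge0//.
  by rewrite !addr_ge0 ?mulr_ge0 ?powR_ge0// ltW.
have Bu1 : B * u <= 1.
  have : B * u <= (beta + 1) * (beta + 1)^-1 by apply: ler_pM => //; lra.
  by rewrite divff// gt_eqF.
have r2 : r ^+ 2 = `|r| ^+ 2 by rewrite real_normK// num_real.
have ar : 1 <= d^-1 * `|r| by rewrite mulrC ler_pdivlMr// mul1r ltW.
have n0 := normr_ge0 r.
have far q : q <= p -> `|r| `^ q <= cc q * `|r| `^ p by move=> qp; apply: powR_le_far => //; exact: ltW.
have f1 := far 1 ltac:(lra); have f2 := far 2 p2; have f3 := far (2 * s) sp.
rewrite powRr1// in f1; rewrite powR_mulrn// -r2 in f2.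
have L1 : ((1 + r) ^+ 2 + B * u) `^ s <= K `^ s * `|r| `^ (2 * s).
  rewrite powRrM powR_mulrn// -powRM ?exprn_ge0//.
  apply: ge0_ler_powR; rewrite ?nnegrE ?(ltW s0)//.
  - by rewrite addr_ge0// sqr_ge0.
  - by rewrite mulr_ge0// sqr_ge0.
  rewrite /K mulrDl -!exprMn; apply: lerD.
    have -> : (1 + r) ^+ 2 = `|1 + r| ^+ 2 by rewrite real_normK// num_real.
    rewrite ler_pXn2r ?nnegrE ?normr_ge0//; last by apply: mulr_ge0 => //; lra.
    apply: (le_trans (ler_normD _ _)); rewrite normr1 mulrDl mul1r; lra.
  by apply: (le_trans Bu1); rewrite exprn_ege1.
have g3 := ler_wpM2l (powR_ge0 K s) f3.
have g1 : - (2 * s * r) <= 2 * s * (cc 1 * `|r| `^ p).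
  have : 2 * s * (- r) <= 2 * s * `|r|.
    by rewrite ler_pM2l ?mulr_gt0//; have := ler_norm (- r); rewrite normrN.
  have : 2 * s * `|r| <= 2 * s * (cc 1 * `|r| `^ p) by rewrite ler_pM2l ?mulr_gt0.
  by rewrite mulrN; lra.
have r20 := sqr_ge0 r.
have g2 : - (s * (2 * s - 1) * r ^+ 2) <= `|s * (2 * s - 1)| * (cc 2 * `|r| `^ p).
  apply: (@le_trans _ _ (`|s * (2 * s - 1)| * r ^+ 2)).
    by rewrite -mulNr ler_wpM2r//; have := ler_norm (- (s * (2 * s - 1))); rewrite normrN.
  by rewrite ler_wpM2l.
have sBu : 0 <= s * B * u by rewrite !mulr_ge0// ltW.
have eu : 0 <= e * (r ^+ 2 + u) by rewrite mulr_ge0 ?addr_ge0// ltW.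
have CE : (K `^ s * cc (2 * s) + 2 * s * cc 1 + `|s * (2 * s - 1)| * cc 2) * `|r| `^ p =
  K `^ s * (cc (2 * s) * `|r| `^ p) + 2 * s * (cc 1 * `|r| `^ p) +
  `|s * (2 * s - 1)| * (cc 2 * `|r| `^ p) by ring.
by rewrite CE; lra.
Qed.

(** * Absolutely summable families *)

Section SignedSum.
Variables (R : realType) (T : choiceType) (D : set T).
Implicit Types f g a b : T -> R.

Definition rsummable f := summable D (EFin \o f).

(** The same shape as [kexp], so that linearity transfers to it. Since [fine] sends an infinite sum
    to 0, linearity and monotonicity are proved under summability. *)
Definition rsum f : R :=
  fine (\esum_(w in D) (Num.max (f w) 0)%:E)%E
  - fine (\esum_(w in D) (Num.max (- f w) 0)%:E)%E.

Lemma eq_rsum f g : (forall w, D w -> f w = g w) -> rsum f = rsum g.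
Proof.
by move=> fg; rewrite /rsum; congr (fine _ - fine _); apply: eq_esum => w Dw; rewrite fg.
Qed.

Lemma ge0_esum_fin f : (forall w, D w -> 0 <= f w) -> rsummable f ->
  (\esum_(w in D) (f w)%:E)%E \is a fin_num.
Proof.
move=> f0; rewrite /rsummable summableE.
rewrite (@eq_esum _ _ _ _ (fun w => (f w)%:E))// => w Dw.
by rewrite /= ger0_norm// f0.
Qed.

Lemma le_rsummable f g : (forall w, D w -> `|f w| <= g w) -> rsummable g -> rsummable f.
Proof.
move=> fg; apply: le_lt_trans; apply: le_esum => w Dw /=.
by rewrite lee_fin (le_trans (fg w Dw))// ler_norm.
Qed.

Lemma rsummable_le f (M : \bar R) : (forall w, D w -> 0 <= f w) -> (M < +oo)%E ->
  (\esum_(w in D) (f w)%:E <= M)%E -> rsummable f.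
Proof.
move=> f0 Moo fM; apply: le_lt_trans Moo; apply: le_trans fM; apply: le_esum => w Dw.
by rewrite /= ger0_norm// f0.
Qed.

Lemma rsummableD f g : rsummable f -> rsummable g -> rsummable (fun w => f w + g w).
Proof. by move=> sf sg; have := summableD sf sg. Qed.

Lemma rsum_ge0E f : (forall w, D w -> 0 <= f w) ->
  rsum f = fine (\esum_(w in D) (f w)%:E)%E.
Proof.
move=> f0; rewrite /rsum [X in _ - fine X](_ : _ = 0%E) ?subr0.
  by congr fine; apply: eq_esum => w Dw; rewrite max_l// f0.
by apply: esum1 => w Dw; rewrite max_r// oppr_le0 f0.
Qed.

Lemma rsum_ge0 f : (forall w, D w -> 0 <= f w) -> 0 <= rsum f.
Proof.
by move=> f0; rewrite rsum_ge0E// fine_ge0// esum_ge0// => w /f0; rewrite lee_fin.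
Qed.

Lemma ge0_rsumD f g : (forall w, D w -> 0 <= f w) -> (forall w, D w -> 0 <= g w) ->
  rsummable f -> rsummable g -> rsum (fun w => f w + g w) = rsum f + rsum g.
Proof.
move=> f0 g0 sf sg.
rewrite !rsum_ge0E//; last by move=> w Dw; rewrite addr_ge0 ?f0 ?g0.
rewrite -fineD; [|exact: ge0_esum_fin..].
by rewrite -esumD// => w Dw; rewrite lee_fin ?f0 ?g0.
Qed.

Lemma rsum_pos_neg f : rsum f =
  rsum (fun w => Num.max (f w) 0) - rsum (fun w => Num.max (- f w) 0).
Proof.
have p0 h w : D w -> 0 <= Num.max (h w) 0 :> R by rewrite le_max lexx orbT.
by rewrite (rsum_ge0E (p0 f)) (rsum_ge0E (p0 (fun w => - f w))).
Qed.

Lemma rsummable_pos f : rsummable f -> rsummable (fun w => Num.max (f w) 0).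
Proof.
apply: le_lt_trans; apply: le_esum => w Dw /=; rewrite lee_fin.
by have [h|h] := leP (f w) 0; rewrite ?normr0 ?normr_ge0 ?lexx.
Qed.

Lemma rsummableN f : rsummable f -> rsummable (fun w => - f w).
Proof. by apply: le_lt_trans; apply: le_esum => w Dw /=; rewrite normrN. Qed.

(** Every decomposition into nonnegative summable families gives the same value, since f = a - b
    makes the families f^+ + b and f^- + a coincide. This reduces signed identities to nonnegative
    ones. *)
Lemma rsum_sub f a b : (forall w, D w -> 0 <= a w) -> (forall w, D w -> 0 <= b w) ->
  rsummable a -> rsummable b -> (forall w, D w -> f w = a w - b w) ->
  rsum f = rsum a - rsum b.
Proof.
move=> a0 b0 sa sb fab.
have sf : rsummable f.
  apply: le_rsummable (rsummableD sa sb) => w Dw; rewrite fab//.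
  by rewrite (le_trans (ler_normB _ _))// !ger0_norm// ?a0 ?b0.
have p0 h w : D w -> 0 <= Num.max (h w) 0 :> R by rewrite le_max lexx orbT.
rewrite rsum_pos_neg; apply/eqP; rewrite subr_eq addrAC eq_sym subr_eq eq_sym; apply/eqP.
rewrite -!ge0_rsumD//; [|exact: p0|exact/rsummable_pos/rsummableN|exact: p0|exact: rsummable_pos].
by apply: eq_rsum => w Dw; rewrite fab//; case: leP => ?; case: leP => ?; lra.
Qed.

Lemma rsumN f : rsum (fun w => - f w) = - rsum f.
Proof.
rewrite /rsum opprB; congr (_ - fine _).
by apply: eq_esum => w _; rewrite opprK.
Qed.

Lemma rsumD f g : rsummable f -> rsummable g ->
  rsum (fun w => f w + g w) = rsum f + rsum g.
Proof.
move=> sf sg; rewrite (rsum_pos_neg f) (rsum_pos_neg g).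
have p0 h w : D w -> 0 <= Num.max (h w) 0 :> R by rewrite le_max lexx orbT.
have [sfp sgp] := (rsummable_pos sf, rsummable_pos sg).
have [sfn sgn] := (rsummable_pos (rsummableN sf), rsummable_pos (rsummableN sg)).
rewrite (@rsum_sub _ (fun w => Num.max (f w) 0 + Num.max (g w) 0)
   (fun w => Num.max (- f w) 0 + Num.max (- g w) 0)).
- rewrite !ge0_rsumD//; [ring|exact: (p0 (fun w => - f w))|exact: (p0 (fun w => - g w))
    |exact: p0|exact: p0].
- by move=> w Dw; rewrite addr_ge0 ?(p0 f) ?(p0 g).
- by move=> w Dw; rewrite addr_ge0 ?(p0 (fun w => - f w)) ?(p0 (fun w => - g w)).
- exact: rsummableD.
- exact: rsummableD.
- by move=> w Dw; case: leP => ?; case: leP => ?; case: leP => ?; case: leP => ?; lra.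
Qed.

Lemma ler_rsum f g : rsummable f -> rsummable g ->
  (forall w, D w -> f w <= g w) -> rsum f <= rsum g.
Proof.
move=> sf sg fg; rewrite -subr_ge0 -rsumN -rsumD//; last exact: rsummableN.
by apply: rsum_ge0 => w Dw; rewrite subr_ge0 fg.
Qed.

Lemma esum_scale_le f (c : R) : 0 <= c -> (forall w, D w -> 0 <= f w) ->
  (\esum_(w in D) (c * f w)%:E <= c%:E * \esum_(w in D) (f w)%:E)%E.
Proof.
move=> c0 f0; apply: ge_ereal_sup => _ [X [finX XD] <-].
rewrite fsumEFin// -mulr_fsumr EFinM -fsumEFin//.
apply: lee_wpmul2l; first by rewrite lee_fin.
by apply: ereal_sup_ubound; exists X.
Qed.

(** The inequality [esum_scale_le], used for c and for 1 / c, gives both directions; c = 0 is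
    treated first. *)
Lemma ge0_rsumZ f (c : R) : 0 <= c -> (forall w, D w -> 0 <= f w) ->
  rsummable f -> rsummable (fun w => c * f w) /\ rsum (fun w => c * f w) = c * rsum f.
Proof.
rewrite le_eqVlt => /predU1P[<- f0 sf|c0 f0 sf].
  have -> : (fun w => 0 * f w) = (fun=> 0) by apply/funext => w; rewrite mul0r.
  have r0 : rsummable (fun=> 0).
    by apply: le_rsummable sf => w Dw; rewrite normr0 f0.
  split => //; rewrite mul0r rsum_ge0E// esum1//.
have cf0 w : D w -> 0 <= c * f w by move=> Dw; rewrite mulr_ge0 ?f0// ltW.
have sfin := ge0_esum_fin f0 sf.
have scf : rsummable (fun w => c * f w).
  apply: (rsummable_le cf0 _ (esum_scale_le (ltW c0) f0)).
  by rewrite -(fineK sfin) -EFinM ltry.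
split => //; rewrite !rsum_ge0E//; apply/eqP; rewrite eq_le; apply/andP; split.
  rewrite -lee_fin fineK; last exact: ge0_esum_fin.
  by rewrite EFinM fineK// esum_scale_le// ltW.
rewrite -ler_pdivlMl//.
have ci : 0 <= c^-1 by rewrite invr_ge0 ltW.
have := esum_scale_le ci cf0.
under eq_esum do rewrite mulKf ?gt_eqF//.
rewrite -lee_fin EFinM !fineK//; exact: ge0_esum_fin.
Qed.

Lemma rsummableZ f (c : R) : rsummable f -> rsummable (fun w => c * f w).
Proof.
move=> sf.
have sa : rsummable (fun w => `|f w|).
  by apply: le_lt_trans sf; apply: le_esum => w Dw /=; rewrite normr_id.
have [+ _] := ge0_rsumZ (normr_ge0 c) (fun w _ => normr_ge0 (f w)) sa.
by apply: le_rsummable => w Dw; rewrite normrM.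
Qed.

Lemma rsumZ f (c : R) : rsummable f -> rsum (fun w => c * f w) = c * rsum f.
Proof.
wlog c0 : c / 0 <= c.
  move=> H sf; have [c0|c0] := leP 0 c; first exact: H.
  have Hc : rsum (fun w => - c * f w) = - c * rsum f by apply: H; rewrite // oppr_ge0 ltW.
  rewrite -[RHS]opprK -mulNr -Hc -rsumN.
  by apply: eq_rsum => w Dw; rewrite mulNr opprK.
move=> sf.
have p0 h w : D w -> 0 <= Num.max (h w) 0 :> R by rewrite le_max lexx orbT.
have sfp := rsummable_pos sf; have sfn := rsummable_pos (rsummableN sf).
have [sp ep] := ge0_rsumZ c0 (p0 f) sfp.
have [sn en] := ge0_rsumZ c0 (p0 (fun w => - f w)) sfn.
rewrite (rsum_pos_neg f) mulrBr -ep -en; apply: rsum_sub => //.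
- by move=> w Dw; rewrite mulr_ge0// (p0 f).
- by move=> w Dw; rewrite mulr_ge0// (p0 (fun w => - f w)).
- by move=> w Dw; rewrite -mulrBr; congr (_ * _); case: leP => ?; case: leP => ?; lra.
Qed.

Lemma rsum_bigsum (I : Type) (r : seq I) (F : I -> T -> R) :
  (forall i, rsummable (F i)) ->
  rsummable (fun w => \sum_(i <- r) F i w) /\
  rsum (fun w => \sum_(i <- r) F i w) = \sum_(i <- r) rsum (F i).
Proof.
move=> sF; elim: r => [|i r [sr ihr]].
  have -> : (fun w => \sum_(i <- [::]) F i w) = (fun=> 0).
    by apply/funext => w; rewrite big_nil.
  split; last by rewrite big_nil rsum_ge0E// esum1.
  by rewrite /rsummable /summable esum1 ?ltry// => w _ /=; rewrite normr0.
have -> : (fun w => \sum_(i <- i :: r) F i w) = (fun w => F i w + \sum_(i <- r) F i w).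
  by apply/funext => w; rewrite big_cons.
by split; [exact: rsummableD|rewrite rsumD// big_cons ihr].
Qed.

End SignedSum.

(** * The Poisson equation of an irreducible stochastic matrix *)

(** Maximum principle: where v is maximal, its average over successors is maximal too, so every
    successor of positive probability attains the maximum; irreducibility spreads this to all of
    [S]. *)
Lemma harmonic_const (R : realType) (S : finType) (q : S -> S -> R) (v : S -> R) :
  stochastic q -> irreducible_matrix q ->
  (forall i, v i = \sum_j q i j * v j) -> forall i j, v i = v j.
Proof.
move=> [q0 q1] qirr hv i0 j0.
pose m := [arg max_(i > i0) v i]%O.
have vm i : v i <= v m by rewrite /m; case: arg_maxP => //= k _; apply.
have step a b : v a = v m -> 0 < q a b -> v b = v m.
  move=> va qab.
  have h0 j : true -> 0 <= q a j * (v m - v j).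
    by move=> _; rewrite mulr_ge0 ?q0// subr_ge0 vm.
  have hs : \sum_j q a j * (v m - v j) = 0.
    under eq_bigr do rewrite mulrBr.
    by rewrite sumrB -mulr_suml q1 mul1r -hv va subrr.
  have /eqP := psumr_eq0P h0 hs (erefl : xpredT b).
  by rewrite mulf_eq0 gt_eqF//= subr_eq0 => /eqP.
have along pth a : v a = v m -> path [rel a b | 0 < q a b] a pth -> v (last a pth) = v m.
  elim: pth a => [//|b pth ih] a va /= /andP[qab]; apply: ih; exact: step qab.
have all_m j : v j = v m by have /connectP[pth /along mp ->] := qirr m j; exact: mp.
by rewrite !all_m.
Qed.

(** Fredholm alternative by a rank count: the range of I - q lies in the annihilator of pi, and both
    have dimension n - 1. *)
Lemma poisson_equation (R : realType) (S : finType) (q : S -> S -> R) (pi g : S -> R) :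
  stochastic q -> irreducible_matrix q -> stationary_distribution q pi ->
  \sum_i pi i * g i = 0 ->
  exists b : S -> R, forall i, b i - \sum_j q i j * b j = g i.
Proof.
move=> sq iq [p0 [p1 pq]] pg.
pose n := #|S|.
have reS (F : S -> R) : \sum_j F j = \sum_(k < n) F (enum_val k).
  by rewrite (reindex (@enum_val S predT))//; apply: onW_bij; exact: enum_val_bij.
(* The transpose of I - q: a row vector v is sent to v - q v, and stationarity says that [A] kills
   the column [P]. *)
pose A : 'M[R]_n := \matrix_(j, i) ((i == j)%:R - q (enum_val i) (enum_val j)).
pose P : 'cV[R]_n := \col_i pi (enum_val i).
have actA (v : 'rV[R]_n) i : (v *m A) 0 i = v 0 i - \sum_(j < n) q (enum_val i) (enum_val j) * v 0 j.
  rewrite mxE (eq_bigr (fun j => (i == j)%:R * v 0 j - q (enum_val i) (enum_val j) * v 0 j)).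
    rewrite sumrB; congr (_ - _).
    rewrite (bigD1 i)//= eqxx mul1r big1 ?addr0// => j ji.
    by rewrite eq_sym (negbTE ji) mul0r.
  by move=> j _; rewrite mxE mulrC mulrBl.
have AP : A *m P = 0.
  apply/matrixP => j k; rewrite !mxE.
  rewrite (eq_bigr (fun i => (i == j)%:R * pi (enum_val i)
      - pi (enum_val i) * q (enum_val i) (enum_val j))); last first.
    by move=> i _; rewrite !mxE mulrBl [q _ _ * _]mulrC.
  rewrite sumrB (bigD1 j)//= eqxx mul1r big1 ?addr0; last first.
    by move=> i ij; rewrite (negbTE ij) mul0r.
  by rewrite -(reS (fun i => pi i * q i (enum_val j))) -pq subrr.
have Pn0 : P != 0.
  apply/eqP => /matrixP P0.
  have : \sum_i pi i = 0 :> R.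
    by rewrite reS big1// => i _; have := P0 i 0; rewrite !mxE.
  by rewrite p1 => /eqP; rewrite oner_eq0.
have rP : \rank P = 1%N.
  apply/eqP; rewrite eqn_leq rank_leq_col/= lt0n mxrank_eq0//.
(* The left kernel consists of harmonic vectors, hence of constant ones. *)
have rker : (\rank (kermx A) <= 1)%N.
  apply: (@leq_trans (\rank (const_mx 1 : 'rV[R]_n))); last exact: rank_leq_row.
  apply/mxrankS/row_subP => k.
  set v := row k (kermx A).
  have vA : v *m A = 0 by apply/sub_kermxP; exact: row_sub.
  have hv : forall i j : S, v 0 (enum_rank i) = v 0 (enum_rank j).
    apply: (harmonic_const sq iq) => i.
    have := actA v (enum_rank i); rewrite vA mxE => /esym/eqP; rewrite subr_eq0 => /eqP ->.
    by rewrite reS; apply: eq_bigr => j _; rewrite enum_rankK enum_valK.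
  have -> : v = v 0 k *: const_mx 1.
    apply/rowP => j; rewrite !mxE mulr1.
    by have := hv (enum_val j) (enum_val k); rewrite !enum_valK !mxE.
  exact: scalemx_sub.
have AK : (A <= kermx P)%MS by apply/sub_kermxP.
(* The annihilator of [P] has dimension n - 1 and rank A >= n - 1, so the inclusion [AK] is an
   equality. *)
have KA : (kermx P <= A)%MS.
  rewrite -(mxrank_leqif_sup AK) eqn_leq mxrankS//= mxrank_ker rP.
  by rewrite leq_subLR addnC -leq_subLR -mxrank_ker.
pose G : 'rV[R]_n := \row_i g (enum_val i).
have GK : (G <= kermx P)%MS.
  apply/sub_kermxP/matrixP => i j; rewrite !mxE -[RHS]pg reS.
  by apply: eq_bigr => k _; rewrite !mxE mulrC.
have /submxP[b bG] := submx_trans GK KA.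
exists (fun i => b 0 (enum_rank i)) => i.
have := actA b (enum_rank i); rewrite -bG mxE enum_rankK => ->.
by rewrite reS; congr (_ - _); apply: eq_bigr => j _; rewrite enum_valK.
Qed.

(** Solve the equation for g - K, with K the pi-mean of g. Rows of q sum to 1, so adding the
    constant M + 1 keeps the equation and moves the solution into [1, 2 M + 1]. *)
Lemma poisson_drift (R : realType) (S : finType) (q : S -> S -> R) (pi g : S -> R) :
  stochastic q -> irreducible_matrix q -> stationary_distribution q pi ->
  \sum_i g i * pi i < 0 ->
  exists b : S -> R, exists k beta : R, [/\ 0 < k, forall i, 1 <= b i <= beta &
    forall i, g i + \sum_j q i j * b j - b i = - k].
Proof.
move=> sq iq sp gneg; set K := \sum_i g i * pi i in gneg.
have [p0 [p1 pq]] := sp.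
have [|b hb] := @poisson_equation _ _ q pi (fun i => g i - K) sq iq sp.
  under eq_bigr do rewrite mulrBr mulrC.
  by rewrite sumrB -mulr_suml p1 mul1r subrr.
pose M := \sum_i `|b i|.
have bM i : `|b i| <= M by rewrite /M (bigD1 i)//= lerDl sumr_ge0.
exists (fun i => b i + (M + 1)), (- K), (2 * M + 1); split.
- by rewrite oppr_gt0.
- by move=> i; have := bM i; rewrite ler_norml => /andP[? ?]; apply/andP; split; lra.
- move=> i; have := hb i; under [in X in _ -> X]eq_bigr do rewrite mulrDr.
  by rewrite big_split/= -mulr_suml (proj2 sq) mul1r; lra.
Qed.

(** * Lyapunov function *)

Section Kernel.
Variables (R : realType) (S : finType) (Sig : set (R * S)).
Variables (P : R * S -> R * S -> R) (z : R * S).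
Hypothesis mk : markov_kernel Sig P.
Hypothesis zS : Sig z.
Implicit Types f g : R * S -> R.

Definition integ f := rsummable Sig (fun w => P z w * f w).

Let P0 w : 0 <= P z w. Proof. by have [h _] := mk zS. Qed.

Lemma kexpE f : kexp Sig P z f = rsum Sig (fun w => P z w * f w).
Proof.
by congr (fine _ - fine _); apply: eq_esum => w _; rewrite -?mulrN maxr_pMr ?mulr0.
Qed.

Lemma kexp_ge0E f : (forall w, Sig w -> 0 <= f w) ->
  kexp Sig P z f = fine (\esum_(w in Sig) (P z w * f w)%:E)%E.
Proof. by move=> f0; rewrite kexpE rsum_ge0E// => w Sw; rewrite mulr_ge0// f0. Qed.

Lemma le_integ f g : (forall w, Sig w -> `|f w| <= g w) -> integ g -> integ f.
Proof.
move=> fg; apply: le_rsummable => w Sw.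
by rewrite normrM (ger0_norm (P0 w)) ler_wpM2l// fg.
Qed.

Lemma integ_cst (a : R) : integ (fun=> a).
Proof.
have [_ [_ h1]] := mk zS.
have i1 : integ (fun=> 1).
  apply: (@rsummable_le _ _ _ _ 1%E) => [w _||]; first by rewrite mulr1.
    by rewrite ltry.
  by under eq_esum do rewrite mulr1; rewrite h1.
have := rsummableZ a i1; congr rsummable; apply/funext => w.
by rewrite mulr1 mulrC.
Qed.

Lemma kexp_cst (a : R) : kexp Sig P z (fun=> a) = a.
Proof.
have [_ [_ h1]] := mk zS.
have e1 : kexp Sig P z (fun=> 1) = 1.
  by rewrite kexp_ge0E//; under eq_esum do rewrite mulr1; rewrite h1.
have := rsumZ a (integ_cst 1); rewrite -kexpE e1 mulr1 => {2}<-.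
by rewrite kexpE; apply: eq_rsum => w _; rewrite mulr1 mulrC.
Qed.

Lemma integD f g : integ f -> integ g -> integ (fun w => f w + g w).
Proof.
move=> sf sg; have := rsummableD sf sg; congr rsummable.
by apply/funext => w; rewrite mulrDr.
Qed.

Lemma integZ (a : R) f : integ f -> integ (fun w => a * f w).
Proof.
move=> sf; have := rsummableZ a sf; congr rsummable.
by apply/funext => w; rewrite mulrCA.
Qed.

Lemma kexpD f g : integ f -> integ g ->
  kexp Sig P z (fun w => f w + g w) = kexp Sig P z f + kexp Sig P z g.
Proof.
move=> sf sg; rewrite !kexpE -rsumD//; apply: eq_rsum => w _; exact: mulrDr.
Qed.

Lemma kexpZ (a : R) f : integ f ->
  kexp Sig P z (fun w => a * f w) = a * kexp Sig P z f.
Proof.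
by move=> sf; rewrite !kexpE -rsumZ//; apply: eq_rsum => w _; exact: mulrCA.
Qed.

Lemma ler_kexp f g : integ f -> integ g -> (forall w, Sig w -> f w <= g w) ->
  kexp Sig P z f <= kexp Sig P z g.
Proof.
move=> sf sg fg; rewrite !kexpE; apply: ler_rsum => // w Sw.
by rewrite ler_wpM2l// fg.
Qed.

Lemma kexp_ge0 f : (forall w, Sig w -> 0 <= f w) -> 0 <= kexp Sig P z f.
Proof. by move=> f0; rewrite kexpE rsum_ge0// => w Sw; rewrite mulr_ge0// f0. Qed.

Lemma kexp_sum (I : Type) (r : seq I) (F : I -> R * S -> R) : (forall i, integ (F i)) ->
  integ (fun w => \sum_(i <- r) F i w) /\
  kexp Sig P z (fun w => \sum_(i <- r) F i w) = \sum_(i <- r) kexp Sig P z (F i).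
Proof.
move=> iF; have [h1 h2] := rsum_bigsum r iF; split.
  by move: h1; congr rsummable; apply/funext => w; rewrite mulr_sumr.
rewrite kexpE; under [RHS]eq_bigr do rewrite kexpE.
by rewrite -h2; apply: eq_rsum => w _; rewrite mulr_sumr.
Qed.

Lemma integ_line (j : S) : integ (fun w => (w.2 == j)%:R).
Proof.
by apply: le_integ (integ_cst 1) => w _; rewrite ger0_norm ?ler0n// lern1 leq_b1.
Qed.

Lemma qxE (j : S) : qx Sig P z.2 j z.1 = kexp Sig P z (fun w => (w.2 == j)%:R).
Proof.
rewrite kexp_ge0E// /qx -surjective_pairing esum_mkcondr; congr fine.
apply: eq_esum => w Sw; have [e|ne] := eqVneq w.2 j.
  by rewrite mem_set// mulr1.
by rewrite memNset ?mulr0//; exact/eqP.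
Qed.

Lemma kexp_line (B : S -> R) : integ (fun w => B w.2) /\
  kexp Sig P z (fun w => B w.2) = \sum_j B j * qx Sig P z.2 j z.1.
Proof.
have -> : (fun w => B w.2) = (fun w : R * S => \sum_j B j * (w.2 == j)%:R).
  apply/funext => w; rewrite (bigD1 w.2)//= eqxx mulr1 big1 ?addr0// => j jw.
  by rewrite eq_sym (negbTE jw) mulr0.
have [h1 h2] := @kexp_sum _ (index_enum S) (fun j w => B j * (w.2 == j)%:R)
   (fun j => integZ (B j) (integ_line j)).
split => //; rewrite h2; apply: eq_bigr => j _.
by rewrite kexpZ ?qxE//; exact: integ_line.
Qed.

End Kernel.

(** * Second-order drift estimate *)

(** Splitting x^(-p) = x^(-(p-2)) x^(-2) shows the role of p > 2: large jumps contribute o(x^-2),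
    below the scale of the drift. *)
Lemma inv_powR_small (R : realType) (p a d : R) : 2 < p -> 0 < d ->
  exists2 x0 : R, 0 < x0 & forall x, x0 <= x -> a * x^-1 `^ p <= d * x^-1 ^+ 2.
Proof.
move=> p2 d0.
have a0 : 0 < `|a| + 1 by rewrite ltr_wpDl.
pose y := (d / (`|a| + 1)) `^ (p - 2)^-1.
have p20 : 0 < p - 2 by lra.
have y0 : 0 < y by rewrite powR_gt0// divr_gt0.
exists y^-1; first by rewrite invr_gt0.
move=> x yx; have x0 : 0 < x by apply: lt_le_trans yx; rewrite invr_gt0.
have xi0 : 0 < x^-1 by rewrite invr_gt0.
have xy : x^-1 <= y by rewrite -[y]invrK lef_pV2// posrE invr_gt0.
have -> : x^-1 `^ p = x^-1 `^ (p - 2) * x^-1 ^+ 2.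
  rewrite -powR_mulrn ?(ltW xi0)// -powRD; first by congr (_ `^ _); ring.
  by rewrite (gt_eqF xi0) implybT.
rewrite mulrA ler_pM2r ?exprn_gt0//.
have h : x^-1 `^ (p - 2) <= d / (`|a| + 1).
  have -> : d / (`|a| + 1) = y `^ (p - 2).
    by rewrite /y -powRrM mulVf ?gt_eqF// powRr1// divr_ge0// ltW.
  by apply: ge0_ler_powR; rewrite ?nnegrE ?(ltW p20) ?(ltW xi0) ?(ltW y0).
apply: (@le_trans _ _ ((`|a| + 1) * (d / (`|a| + 1)))); last first.
  by rewrite mulrC divfK// gt_eqF.
apply: (@le_trans _ _ ((`|a| + 1) * x^-1 `^ (p - 2))).
  by rewrite ler_wpM2r ?powR_ge0//; have := ler_norm a; lra.
by rewrite ler_pM2l.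
Qed.

(** The sum of the |M i| serves as a common threshold. *)
Lemma eventually_finType (R : realType) (S : finType) (Q : S -> R -> Prop) :
  (forall i, exists M : R, forall x, M <= x -> Q i x) ->
  exists M : R, forall i x, M <= x -> Q i x.
Proof.
move=> /choice[M HM].
exists (\sum_i `|M i|) => i x Mx; apply: HM; apply: le_trans Mx.
by rewrite (bigD1 i)//= (le_trans (ler_norm _))// lerDl sumr_ge0.
Qed.

(** Transfers powers of x^2 + B to powers of x^2. As 1 <= 1 + B / X <= 2, the exponent |t| in the
    constant covers negative t as well. *)
Lemma powR_succ_le (R : realType) (t B X : R) : 0 < X -> 0 <= B -> B <= X ->
  (X + B) `^ t <= 2 `^ `|t| * X `^ t.
Proof.
move=> X0 B0 BX.
have -> : X + B = (1 + B / X) * X by field; rewrite gt_eqF.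
have b0 : 0 <= B / X by rewrite divr_ge0// ltW.
have b1 : B / X <= 1 by rewrite ler_pdivrMr// mul1r.
rewrite powRM ?(ltW X0)//; last by lra.
apply: ler_wpM2r; first exact: powR_ge0.
apply: (@le_trans _ _ ((1 + B / X) `^ `|t|)).
  by apply: ler_powR; [lra|exact: ler_norm].
apply: ge0_ler_powR; rewrite ?nnegrE ?normr_ge0//; lra.
Qed.

(** Factor out x^2 and put r = (y - x) / x, u = x^-2. The first bound is for the value after a jump
    to y, the second for the value at the starting point. *)
Lemma drift_pointwise (R : realType) (s p e beta : R) :
  0 < s -> 2 * s <= p -> 2 <= p -> 0 < e -> 0 <= beta ->
  exists C x0 : R, [/\ 0 <= C, 0 < x0 & forall x y B : R,
    x0 <= x -> 0 <= B <= beta ->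
    (y ^+ 2 + B) `^ s <= (x ^+ 2) `^ s * (
      (1 + e * x^-1 ^+ 2) + 2 * s * x^-1 * (y - x)
      + (s * (2 * s - 1) + e) * x^-1 ^+ 2 * (y - x) ^+ 2
      + s * x^-1 ^+ 2 * B + C * x^-1 `^ p * `|y - x| `^ p) /\
    (x ^+ 2) `^ s * (1 + (s * B - e) * x^-1 ^+ 2) <= (x ^+ 2 + B) `^ s].
Proof.
move=> s0 sp p2 e0 b0.
have [C [u0 [C0 u00 H]]] := powR_quad_bound s0 sp p2 e0 b0.
have [u1 u10 L] := @powR_lower1 R s e beta e0 b0.
(* The cap 1 gives x^-2 <= x^-1 <= m, so one threshold on x meets both conditions on u. *)
pose m := Num.min u0 (Num.min u1 1).
have m0 : 0 < m by rewrite !lt_min u00 u10 ltr01.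
exists C, m^-1; split => //; first by rewrite invr_gt0.
move=> x y B mx /andP[B0 Bb].
have x0 : 0 < x by apply: lt_le_trans mx; rewrite invr_gt0.
have xi : x^-1 <= m by rewrite -[m]invrK lef_pV2// posrE invr_gt0.
have xi0 : 0 < x^-1 by rewrite invr_gt0.
have m1 : m <= 1 by rewrite /m !ge_min lexx !orbT.
have um : x^-1 ^+ 2 <= m by rewrite expr2 (le_trans _ xi)// ler_piMl ?(ltW xi0)//; lra.
have uu0 : x^-1 ^+ 2 <= u0 by rewrite (le_trans um)// /m ge_min lexx.
have uu1 : x^-1 ^+ 2 <= u1 by rewrite (le_trans um)// /m !ge_min lexx orbT.
have ug : 0 <= x^-1 ^+ 2 by rewrite sqr_ge0.
have X0 : 0 < x ^+ 2 by rewrite exprn_gt0.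
split.
  have -> : y ^+ 2 + B = x ^+ 2 * ((1 + x^-1 * (y - x)) ^+ 2 + B * x^-1 ^+ 2).
    by field; rewrite gt_eqF.
  rewrite powRM ?(ltW X0)//; last by rewrite addr_ge0 ?sqr_ge0// mulr_ge0.
  apply: ler_wpM2l; first exact: powR_ge0.
  apply: (le_trans (H (x^-1 * (y - x)) _ _ ug uu0 B0 Bb)).
  rewrite normrM (ger0_norm (ltW xi0)) powRM ?(ltW xi0)//.
  rewrite le_eqVlt; apply/predU1P; left; ring.
have -> : x ^+ 2 + B = x ^+ 2 * (1 + B * x^-1 ^+ 2) by field; rewrite gt_eqF.
rewrite powRM ?(ltW X0)//; last by rewrite addr_ge0// mulr_ge0.
apply: ler_wpM2l; first exact: powR_ge0.
by apply: le_trans (L _ _ ug uu1 B0 Bb); rewrite le_eqVlt; apply/predU1P; left; ring.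
Qed.

(** Used to derive integrability of the increment and of its square from the p-th moment. *)
Lemma norm_le_powR (R : realType) (p a : R) : 2 <= p ->
  `|a| <= 1 + `|a| `^ p /\ a ^+ 2 <= 1 + `|a| `^ p.
Proof.
move=> p2; have ap := powR_ge0 `|a| p; have a0 := normr_ge0 a.
have -> : a ^+ 2 = `|a| ^+ 2 by rewrite real_normK// num_real.
have [a1|a1] := leP `|a| 1.
  by split; last rewrite expr2 (@le_trans _ _ 1) ?mulr_ile1//; lra.
have h1 : `|a| <= `|a| `^ p by apply: le1r_powR; lra.
have h2 : `|a| `^ 2 <= `|a| `^ p by apply: ler_powR; lra.
rewrite powR_mulrn// in h2; lra.
Qed.

(** Averaging [drift_pointwise] gives x^(2s-2) the coefficient s (2 c_i + (2 s - 1) s2_i + sum_j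
    q_ij B_j - B_i) = - s k, by the Poisson equation. All errors together stay below s k / 2. *)
Lemma lyapunov_drift (R : realType) (S : finType) (Sig : set (R * S))
  (P : R * S -> R * S -> R) (p Cp : R) (q : S -> S -> R) (pi : S -> R)
  (c s2 : S -> R) (s : R) :
  markov_kernel Sig P -> 2 < p ->
  (forall z, Sig z ->
     (\esum_(w in Sig) (P z w * `|w.1 - z.1| `^ p)%:E <= Cp%:E)%E) ->
  (forall i j (e : R), 0 < e -> exists M : R, forall x : R,
     Sig (x, i) -> M <= x -> `|qx Sig P i j x - q i j| < e) ->
  stochastic q -> irreducible_matrix q -> stationary_distribution q pi ->
  (forall i, 0 <= s2 i) ->
  (forall i (e : R), 0 < e -> exists M : R, forall x : R,
     Sig (x, i) -> M <= x -> `|x * mu Sig P i x - c i| < e) ->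
  (forall i (e : R), 0 < e -> exists M : R, forall x : R,
     Sig (x, i) -> M <= x -> `|sigma2 Sig P i x - s2 i| < e) ->
  0 < s -> 2 * s <= p ->
  \sum_i (2 * c i + (2 * s - 1) * s2 i) * pi i < 0 ->
  exists (B : S -> R) (eps x0 : R), [/\ 0 < eps, (forall i, 1 <= B i) &
    forall z, Sig z -> x0 <= z.1 ->
      integ Sig P z (fun w => (w.1 ^+ 2 + B w.2) `^ s) /\
      kexp Sig P z (fun w => (w.1 ^+ 2 + B w.2) `^ s) <=
        (z.1 ^+ 2 + B z.2) `^ s - eps * (z.1 ^+ 2 + B z.2) `^ (s - 1)].
Proof.
move=> mk p2 mom hq sq iq stq s20 hc hs s0 sp neg.
have [B [k [beta [k0 hB hk]]]] := poisson_drift sq iq stq neg.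
pose Sm := \sum_i s2 i; pose Bm := \sum_i B i.
have Sm0 : 0 <= Sm by exact: sumr_ge0.
have Bm0 : 0 <= Bm by apply: sumr_ge0 => i _; have /andP[] := hB i; lra.
have s2m i : s2 i <= Sm by rewrite /Sm (bigD1 i)//= lerDl sumr_ge0.
have sk0 : 0 < s * k by exact: mulr_gt0.
(* The Taylor error enters once with weight s2_i <= Sm and twice with weight 1, so it costs at most
   s k / 8. *)
pose e := s * k / (8 * (Sm + 2)).
have e0 : 0 < e by rewrite divr_gt0// mulr_gt0 ?ltr0n//; lra.
have eSm : 8 * (e * (Sm + 2)) = s * k by rewrite /e; field; rewrite gt_eqF//; lra.
(* The weights with which the errors in mu, sigma2 and q enter; with [eta] these cost s k / 8 in
   all. The p-th moment term takes another s k / 8. *)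
pose W := 2 * s + `|s * (2 * s - 1) + e| + s * Bm.
have W0 : 0 < W.
  by rewrite /W -addrA ltr_wpDr ?mulr_gt0// addr_ge0// mulr_ge0// ltW.
pose eta := s * k / (8 * W).
have eta0 : 0 < eta by rewrite divr_gt0// mulr_gt0 ?ltr0n.
have etaW : 8 * (eta * W) = s * k by rewrite /eta; field; rewrite gt_eqF.
(* A point of [S] is needed to know beta >= 0; without one the claim is vacuous. *)
have [i0 _|noS] := pickP (fun _ : S => true); last first.
  by exists (fun=> 1), 1, 0; split=> // -[x i]; have := noS i.
have beta0 : 0 <= beta by have /andP[] := hB i0; lra.
have [C [x1 [C0 x10 Hpt]]] := drift_pointwise s0 sp (ltW p2) e0 beta0.
have [x2 x20 Hp] := @inv_powR_small R p (C * Cp) (s * k / 8) p2 (divr_gt0 sk0 (ltr0n R 8)).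
have [M1 HM1] : exists M, forall i x, M <= x -> Sig (x, i) -> `|x * mu Sig P i x - c i| < eta.
  by apply: eventually_finType => i; have [M HM] := hc i eta eta0; exists M => x ? ?; exact: HM.
have [M2 HM2] : exists M, forall i x, M <= x -> Sig (x, i) -> `|sigma2 Sig P i x - s2 i| < eta.
  by apply: eventually_finType => i; have [M HM] := hs i eta eta0; exists M => x ? ?; exact: HM.
have [M3 HM3] : exists M, forall (ij : S * S) x, M <= x -> Sig (x, ij.1) ->
    `|qx Sig P ij.1 ij.2 x - q ij.1 ij.2| < eta.
  apply: eventually_finType => ij; have [M HM] := hq ij.1 ij.2 eta eta0.
  by exists M => x ? ?; exact: HM.
(* The factor 2^|s-1| pays for replacing x^2 by x^2 + B_i in the power s - 1; the threshold beta + 1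
   ensures B_i <= x^2. *)
exists B, (s * k / 2 / 2 `^ `|s - 1|),
  (Num.max x1 (Num.max x2 (Num.max M1 (Num.max M2 (Num.max M3 (beta + 1)))))).
have two0 : 0 < 2 `^ `|s - 1| :> R by rewrite powR_gt0.
split.
- by rewrite !divr_gt0.
- by move=> i; have /andP[] := hB i.
move=> [x i] zS /=; rewrite !ge_max => /andP[xx1 /andP[xx2 /andP[xM1 /andP[xM2 /andP[xM3 xb]]]]].
have x0 : 0 < x by apply: lt_le_trans xx1.
have xi0 : 0 < x^-1 by rewrite invr_gt0.
set u := x^-1 ^+ 2.
have u0 : 0 < u by rewrite exprn_gt0.
set z := (x, i) in zS *.
pose Dp := fun w : R * S => `|w.1 - x| `^ p.
have Dp0 w : 0 <= Dp w by exact: powR_ge0.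
have P0 w : 0 <= P z w by have [h _] := mk _ zS.
have iDp : integ Sig P z Dp.
  by apply: (rsummable_le _ _ (mom z zS)) => [w Sw|]; rewrite ?mulr_ge0// ltry.
have eDp : kexp Sig P z Dp <= Cp.
  rewrite (kexp_ge0E mk zS)// -lee_fin fineK ?(mom z zS)//.
  by apply: ge0_esum_fin iDp => w _; rewrite mulr_ge0.
have i1Dp := integD (integ_cst mk zS 1) iDp.
have iD : integ Sig P z (fun w => w.1 - x).
  by apply: (le_integ mk zS) i1Dp => w _; have [] := norm_le_powR (w.1 - x) (ltW p2).
have iD2 : integ Sig P z (fun w => (w.1 - x) ^+ 2).
  apply: (le_integ mk zS) i1Dp => w _; rewrite ger0_norm ?sqr_ge0//.
  by have [] := norm_le_powR (w.1 - x) (ltW p2).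
have [iB eB] := kexp_line mk zS B.
set X := x ^+ 2.
have X0 : 0 < X by rewrite exprn_gt0.
have Xs0 : 0 < X `^ s by rewrite powR_gt0.
pose a0 := 1 + e * u; pose a1 := 2 * s * x^-1; pose a2 := (s * (2 * s - 1) + e) * u.
pose a3 := s * u; pose a4 := C * x^-1 `^ p.
pose G := fun w : R * S => X `^ s * ((((a0 + a1 * (w.1 - x)) + a2 * (w.1 - x) ^+ 2)
   + a3 * B w.2) + a4 * Dp w).
have i_0 := integ_cst mk zS a0.
have i_1 := integD i_0 (integZ a1 iD).
have i_2 := integD i_1 (integZ a2 iD2).
have i_3 := integD i_2 (integZ a3 iB).
have i_4 := integD i_3 (integZ a4 iDp).
have iG : integ Sig P z G by exact: integZ.
have VG w : Sig w -> (w.1 ^+ 2 + B w.2) `^ s <= G w.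
  move=> Sw; have /andP[b1 b2] := hB w.2.
  have Bw : 0 <= B w.2 <= beta by rewrite b2 andbT (le_trans ler01).
  by have [+ _] := Hpt x w.1 (B w.2) xx1 Bw.
have iV : integ Sig P z (fun w => (w.1 ^+ 2 + B w.2) `^ s).
  by apply: (le_integ mk zS) iG => w Sw; rewrite ger0_norm ?powR_ge0// VG.
split => //.
have eG : kexp Sig P z G = X `^ s * (a0 + a1 * mu Sig P i x + a2 * sigma2 Sig P i x
    + a3 * (\sum_j B j * qx Sig P i j x) + a4 * kexp Sig P z Dp).
  rewrite (kexpZ mk zS)//; congr (_ * _).
  rewrite (kexpD mk zS i_3 (integZ a4 iDp)) (kexpD mk zS i_2 (integZ a3 iB)).
  rewrite (kexpD mk zS i_1 (integZ a2 iD2)) (kexpD mk zS i_0 (integZ a1 iD)).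
  by rewrite (kexp_cst mk zS) !(kexpZ mk zS)// eB.
apply: (le_trans (ler_kexp mk zS iV iG VG)); rewrite eG.
have /andP[b1 b2] := hB i.
have Bi0 : 0 <= B i by rewrite (le_trans ler01).
have Bi : 0 <= B i <= beta by rewrite b2 andbT.
have [_ low] := Hpt x x (B i) xx1 Bi.
have bX : B i <= X.
  rewrite /X expr2 (le_trans b2)// (@le_trans _ _ (1 * x))// ?ler_pM2r//.
    by rewrite mul1r (le_trans _ xb)// lerDl.
  by rewrite (le_trans _ xb)// lerDr.
have up : (X + B i) `^ (s - 1) <= 2 `^ `|s - 1| * X `^ (s - 1).
  exact: powR_succ_le.
have Xsu : X `^ (s - 1) = X `^ s * u.
  rewrite -(mulr_powRB1 (ltW X0) s0) mulrAC /X /u exprVn divff ?mul1r//.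
  by rewrite gt_eqF.
rewrite -/X -/u in low.
suff br : a0 + a1 * mu Sig P i x + a2 * sigma2 Sig P i x
    + a3 * (\sum_j B j * qx Sig P i j x) + a4 * kexp Sig P z Dp
    <= 1 + (s * B i - e) * u - s * k / 2 * u.
  apply: (le_trans (ler_wpM2l (ltW Xs0) br)); rewrite mulrBr; apply: lerB => //.
  rewrite mulrAC ler_pdivrMr//.
  have : s * k / 2 * (X + B i) `^ (s - 1) <= s * k / 2 * (2 `^ `|s - 1| * X `^ (s - 1)).
    by apply: ler_wpM2l => //; rewrite divr_ge0// ltW.
  rewrite Xsu => /le_trans; apply; rewrite le_eqVlt; apply/predU1P; left; ring.
have {}hk := hk i.
have t1 : a1 * mu Sig P i x = 2 * s * (x * mu Sig P i x) * u.
  by rewrite /a1 /u; field; rewrite gt_eqF.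
have m1 : 2 * s * (x * mu Sig P i x) <= 2 * s * (c i + eta).
  have := HM1 i x xM1 zS; rewrite ltr_norml => /andP[_ h].
  by rewrite ler_pM2l ?mulr_gt0//; lra.
have m2 : (s * (2 * s - 1) + e) * sigma2 Sig P i x <=
    (s * (2 * s - 1) + e) * s2 i + `|s * (2 * s - 1) + e| * eta.
  have h := ltW (HM2 i x xM2 zS).
  have := ler_norm ((s * (2 * s - 1) + e) * (sigma2 Sig P i x - s2 i)).
  rewrite normrM => h'; have := ler_wpM2l (normr_ge0 (s * (2 * s - 1) + e)) h.
  rewrite mulrBr in h'; lra.
have m3 : \sum_j B j * qx Sig P i j x <= \sum_j q i j * B j + Bm * eta.
  rewrite /Bm mulr_suml -big_split/=; apply: ler_sum => j _.
  have := HM3 (i, j) x xM3 zS; rewrite /= ltr_norml => /andP[_ h].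
  have Bj : 0 <= B j by have /andP[/(le_trans ler01)] := hB j.
  have : B j * qx Sig P i j x <= B j * (q i j + eta) by apply: ler_wpM2l => //; lra.
  by rewrite mulrDr [q i j * _]mulrC.
have m4 : a4 * kexp Sig P z Dp <= s * k / 8 * u.
  apply: le_trans (Hp x xx2); rewrite /a4 mulrAC ler_wpM2r ?powR_ge0//.
  by rewrite ler_wpM2l.
set Q := \sum_j B j * qx Sig P i j x in m3 *.
set Q' := \sum_j q i j * B j in hk m3.
have m3' : s * Q <= s * (Q' + Bm * eta) by rewrite ler_pM2l.
have es : e * s2 i <= e * Sm by rewrite ler_pM2l.
set mx := x * mu Sig P i x in t1 m1; set sg := sigma2 Sig P i x in m2 *.
have hsk : s * (2 * c i + (2 * s - 1) * s2 i) + s * Q' - s * B i = - (s * k).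
  by rewrite -[RHS]mulrN -hk; ring.
have tot : 2 * s * mx + (s * (2 * s - 1) + e) * sg + s * Q + e + s * k / 8
   <= s * B i - e - s * k / 2.
  have w : 2 * s * eta + `|s * (2 * s - 1) + e| * eta + s * (Bm * eta) = eta * W.
    by rewrite /W; ring.
  lra.
have := ler_wpM2r (ltW u0) tot.
rewrite t1 /a0 /a2 /a3; lra.
Qed.

(** * From drift to moments of the hitting time *)

Section Survival.
Variables (R : realType) (S : finType) (Sig : set (R * S)).
Variables (P : R * S -> R * S -> R) (l : R).
Hypothesis mk : markov_kernel Sig P.
Local Notation sv := (surv Sig P l).
Local Notation tp := (tau_prob Sig P l).

Lemma surv_low z n : z.1 <= l -> sv n z = 0.
Proof. by rewrite leNgt => /negbTE zl; case: n => [|n]; rewrite /= zl. Qed.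

Lemma surv_bounds n z : Sig z -> 0 <= sv n z <= 1.
Proof.
elim: n z => [|n ih] z zS /=; first by rewrite ler0n lern1 leq_b1.
case: ifP => _; last by rewrite lexx ler01.
have s0 w : Sig w -> 0 <= sv n w by move=> /ih/andP[].
rewrite -(kexp_ge0E mk zS s0) kexp_ge0//=.
rewrite -[leRHS](kexp_cst mk zS) (ler_kexp mk zS)//; last by move=> w /ih/andP[].
  apply: (le_integ mk zS) (integ_cst mk zS 1) => w wS.
  by rewrite ger0_norm ?s0//; have /andP[] := ih w wS.
exact: integ_cst.
Qed.

Lemma surv_ge0 n z : Sig z -> 0 <= sv n z.
Proof. by move=> zS; have /andP[] := surv_bounds n zS. Qed.

Lemma surv_le1 n z : Sig z -> sv n z <= 1.
Proof. by move=> zS; have /andP[] := surv_bounds n zS. Qed.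

Lemma integ_surv n z : Sig z -> integ Sig P z (sv n).
Proof.
move=> zS; apply: (le_integ mk zS) (integ_cst mk zS 1) => w wS.
by rewrite ger0_norm ?surv_ge0// surv_le1.
Qed.

Lemma survS n z : Sig z -> l < z.1 -> sv n.+1 z = kexp Sig P z (sv n).
Proof.
by move=> zS lz; rewrite (kexp_ge0E mk zS)/= ?lz// => w; exact: surv_ge0.
Qed.

Lemma surv_decr n z : Sig z -> sv n.+1 z <= sv n z.
Proof.
elim: n z => [|n ih] z zS; have [zl|lz] := leP z.1 l; rewrite ?(surv_low _ zl)//.
  by apply: le_trans (surv_le1 1 zS) _; rewrite /= lz.
rewrite (survS n.+1 zS lz) (survS n zS lz).
by apply: (ler_kexp mk zS) => //; exact: integ_surv.
Qed.

Lemma tau_prob_ge0 n z : Sig z -> 0 <= tp z n.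
Proof.
move=> zS; case: n => [|n]; rewrite /tau_prob subr_ge0.
  exact: surv_le1.
exact: surv_decr.
Qed.

(** Summation by parts: both sides are the expectation of a at min(tau, N). *)
Lemma sum_tau_prob (a : nat -> R) z N :
  \sum_(k < N.+1) a k * tp z k + a N * sv N z =
  a 0%N + \sum_(k < N) (a k.+1 - a k) * sv k z.
Proof.
elim: N => [|N ih].
  by rewrite big_ord_recl !big_ord0 !addr0 [nat_of_ord ord0]/= -mulrDr subrK mulr1.
rewrite big_ord_recr [in RHS]big_ord_recr/= addrA -ih /tau_prob; ring.
Qed.

(** The second bound forces the survival probability to 0, which removes the infinite term of
    [tau_moment]; the first bounds the series after summation by parts. *)
Lemma tau_moment_lty (s t M1 M2 : R) z : Sig z -> 0 < t ->
  (forall N, \sum_(k < N) (k.+1%:R `^ s - k%:R `^ s) * sv k z <= M1) ->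
  (forall N, N%:R `^ t * sv N z <= M2) ->
  (tau_moment Sig P l s z < +oo)%E.
Proof.
move=> zS t0 hM1 hM2.
have inf0 : tau_inf_prob Sig P l z <= 0.
  rewrite leNgt; apply/negP => L0; set L := tau_inf_prob Sig P l z in L0.
  have dec : nonincreasing_seq (fun n => sv n z).
    by apply/nonincreasing_seqP => n; exact: surv_decr.
  have cv : cvgn (fun n => sv n z).
    by apply: nonincreasing_is_cvgn => //; exists 0 => _ [n _ <-]; exact: surv_ge0.
  have Lle n : L <= sv n z by exact: nonincreasing_cvgn_ge.
  (* Any N >= y has N^t L >= |M2| + L > M2, against the second bound. *)
  pose y := (`|M2| / L + 1) `^ t^-1.
  have y0 : 0 <= y by exact: powR_ge0.
  have := Num.Theory.archi_boundP y0; set N := Num.bound y => yN.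
  have h1 : `|M2| / L + 1 <= N%:R `^ t.
    have -> : `|M2| / L + 1 = y `^ t.
      rewrite /y -powRrM mulVf ?gt_eqF// powRr1// addr_ge0// divr_ge0//; exact: ltW.
    by apply: ge0_ler_powR; rewrite ?nnegrE ?(ltW t0) ?ler0n// ltW.
  have h2 : (`|M2| / L + 1) * L <= M2.
    apply: le_trans (hM2 N); apply: ler_pM => //; last exact: ltW.
    by rewrite addr_ge0// divr_ge0// ltW.
  by move: h2; rewrite mulrDl divfK ?gt_eqF// mul1r; have := ler_norm M2; lra.
have nL : (0 < tau_inf_prob Sig P l z) = false by apply/negbTE; rewrite -leNgt.
rewrite /tau_moment nL adde0.
have term0 n : (0 <= (n%:R `^ s * tp z n)%:E)%E.
  by rewrite lee_fin mulr_ge0 ?powR_ge0// tau_prob_ge0.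
rewrite -nneseries_esumT//.
(* The boundary term 0^s is kept because it equals 1 when s = 0. *)
apply: (@le_lt_trans _ _ (0 `^ s + M1)%:E); last exact: ltry.
apply: lime_le; first exact: is_cvg_nneseries.
apply: nearW => N; rewrite big_mkord sumEFin lee_fin.
apply: (@le_trans _ _ (\sum_(k < N.+1) k%:R `^ s * tp z k + N%:R `^ s * sv N z)).
  rewrite big_ord_recr/= -addrA lerDl addr_ge0 ?mulr_ge0 ?powR_ge0//.
    exact: tau_prob_ge0.
  exact: surv_ge0.
by rewrite (sum_tau_prob (fun k => k%:R `^ s)) lerD2l.
Qed.

Variables (U : R * S -> R) (eps : R).
Hypotheses (U0 : forall w, 0 < U w) (eps0 : 0 < eps).

(** The left side is the expectation of a at n + min(tau, N), so this is the supermartingale bound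
    for (U + (eps/s) n)^s. Induction on N conditions on the first step, which advances the clock;
    hence n is free. *)
Lemma surv_sum_bound (s : R) : 1 <= s ->
  (forall z, Sig z -> l < z.1 -> integ Sig P z (fun w => U w `^ s) /\
    kexp Sig P z (fun w => U w `^ s) <= U z `^ s - eps * U z `^ (s - 1)) ->
  let a n := (eps / s * n%:R) `^ s in
  forall N n z, Sig z ->
  a n + \sum_(k < N) (a (n + k).+1 - a (n + k)%N) * sv k z <= (U z + eps / s * n%:R) `^ s.
Proof.
move=> s1 drift a; have s0 : 0 < s by exact: lt_le_trans s1.
have es0 : 0 < eps / s by rewrite divr_gt0.
have cn0 n : 0 <= eps / s * n%:R by rewrite mulr_ge0// ltW.
have base n z : a n <= (U z + eps / s * n%:R) `^ s.
  have Uz := ltW (U0 z).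
  by apply: ge0_ler_powR; rewrite ?nnegrE ?(ltW s0) ?cn0 ?addr_ge0 ?cn0// lerDr.
elim=> [|N ih] n z zS; first by rewrite big_ord0 addr0.
have [zl|lz] := leP z.1 l.
  by rewrite big1 ?addr0// => k _; rewrite surv_low ?mulr0.
have [iU dU] := drift z zS lz.
have sv0 : sv 0 z = 1 by rewrite /= lz.
(* The k = 0 increment turns a n into a n.+1; the rest is the expectation of the left side for N
   steps with clock n.+1. *)
rewrite big_ord_recl addn0 sv0 mulr1 addrA subrKC.
set A := eps / s * n.+1%:R.
have A0 : 0 <= A by exact: cn0.
have UA : 0 < U z + A by rewrite ltr_wpDr.
pose F k := fun w : R * S => (a (n.+1 + k).+1 - a (n.+1 + k)%N) * sv k w.
have iF (k : 'I_N) : integ Sig P z (F k).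
  by apply: integZ; exact: integ_surv.
have [isF esF] := @kexp_sum _ _ _ _ _ mk zS _ (index_enum 'I_N) (fun k : 'I_N => F k) iF.
rewrite (eq_bigr (fun k : 'I_N => kexp Sig P z (F k))); last first.
  move=> k _; rewrite (kexpZ mk zS); last exact: integ_surv.
  by rewrite (_ : lift ord0 k = k.+1 :> nat)// survS// !addnS !addSn.
rewrite -[X in a n.+1 + X]esF -(kexp_cst mk zS (a n.+1)) -(kexpD mk zS)//; last exact: integ_cst.
(* The slope of v -> (v^(1/s) + A)^s at v = U^s; being nonnegative, it may multiply the drift
   inequality. *)
pose b := (U z + A) `^ (s - 1) * U z `^ (1 - s).
have b0 : 0 <= b by rewrite mulr_ge0 ?powR_ge0.
pose T w := ((U z + A) `^ s - b * U z `^ s) + b * U w `^ s.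
have iT : integ Sig P z T.
  by apply: integD; [exact: integ_cst|exact: integZ].
apply: (@le_trans _ _ (kexp Sig P z T)).
  apply: (ler_kexp mk zS) => //; first by apply: integD => //; exact: integ_cst.
  move=> w wS; apply: le_trans (ih n.+1 w wS) _.
  have := powR_shift_tangent s1 A0 (U0 z) (ltW (U0 w)).
  by rewrite -/A -/b /T mulrBr; lra.
rewrite (kexpD mk zS) ?(kexp_cst mk zS) ?(kexpZ mk zS)//; last 2 first.
- exact: integ_cst.
- exact: integZ.
have hb := ler_wpM2l b0 dU.
have bU : b * (eps * U z `^ (s - 1)) = eps * (U z + A) `^ (s - 1).
  rewrite /b mulrCA -mulrA -powRD; last by rewrite (gt_eqF (U0 z)) implybT.
  by rewrite subrKA subrr powRr0 mulr1.
have y0 : 0 <= U z + eps / s * n%:R by rewrite addr_ge0 ?(ltW (U0 z))// cn0.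
(* The drift now gains eps (U + A)^(s-1); by convexity of the power s this pays for lowering U + A
   by eps / s, one tick of the clock. *)
have := powR_tangent s1 UA y0.
have -> : s * (U z + A) `^ (s - 1) * (U z + eps / s * n%:R - (U z + A)) =
   - (eps * (U z + A) `^ (s - 1)).
  by rewrite /A -natr1; field; rewrite gt_eqF.
by move: hb; move: (kexp Sig P z _) => E; rewrite [b * (_ - _)]mulrBr bU; lra.
Qed.

(** For fixed N, [claim] is proved by induction on m. If U >= N then U^s >= K and the bound sv <= 1
    suffices; otherwise U^s drops on average by at least d. At m = N one has m d = eps K. *)
Lemma surv_tail_bound (s : R) : 0 < s -> s <= 1 ->
  (forall z, Sig z -> l < z.1 -> integ Sig P z (fun w => U w `^ s) /\
    kexp Sig P z (fun w => U w `^ s) <= U z `^ s - eps * U z `^ (s - 1)) ->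
  forall N z, Sig z -> eps * (N%:R `^ s * sv N z) <= (1 + eps) * U z `^ s.
Proof.
move=> s0 s1 drift [|N'] z zS.
  by rewrite powR0 ?gt_eqF// mul0r mulr0 mulr_ge0 ?powR_ge0// addr_ge0// ltW.
set N := N'.+1.
have N0 : 0 < N%:R :> R by rewrite ltr0n.
pose d := eps * N%:R `^ (s - 1); pose K : R := N%:R `^ s.
have d0 : 0 < d by rewrite mulr_gt0// powR_gt0.
have K0 : 0 < K by rewrite powR_gt0.
have V0 w : 0 <= U w `^ s by exact: powR_ge0.
have dK0 m : 0 <= m%:R * d / K by rewrite divr_ge0 ?mulr_ge0// ltW.
have claim m w : Sig w -> m%:R * d * sv m w <= U w `^ s * (1 + m%:R * d / K).
  elim: m w => [|m ih] w wS; first by rewrite !mul0r addr0 mulr1.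
  have [KU|UK] := leP N%:R (U w).
    have KV : K <= U w `^ s.
      by apply: ge0_ler_powR; rewrite ?nnegrE ?(ltW s0) ?(ltW N0) ?(ltW (U0 w)).
    have md0 : 0 <= m.+1%:R * d by rewrite mulr_ge0// ltW.
    apply: (@le_trans _ _ (m.+1%:R * d * 1)).
      by rewrite ler_wpM2l// surv_le1.
    apply: (@le_trans _ _ (K * (1 + m.+1%:R * d / K))); last first.
      by rewrite ler_wpM2r// addr_ge0.
    have -> : K * (1 + m.+1%:R * d / K) = K + m.+1%:R * d by field; rewrite gt_eqF.
    by rewrite mulr1 lerDr ltW.
  have [wl|lw] := leP w.1 l.
    by rewrite surv_low// mulr0 mulr_ge0// addr_ge0.
  have [iV dV] := drift w wS lw.
  (* As s <= 1, the power s - 1 is nonincreasing, so U < N only strengthens the drift. *)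
  have ed : d <= eps * U w `^ (s - 1).
    rewrite ler_pM2l// -opprB !powRN lef_pV2 ?posrE ?powR_gt0//.
    by apply: ge0_ler_powR; rewrite ?nnegrE ?subr_ge0 ?(ltW N0) ?(ltW (U0 w)) ?(ltW UK).
  have Es : m%:R * d * sv m.+1 w <= (U w `^ s - d) * (1 + m%:R * d / K).
    rewrite survS// -(kexpZ mk wS); last exact: integ_surv.
    apply: (@le_trans _ _ (kexp Sig P w (fun w => (1 + m%:R * d / K) * U w `^ s))).
      apply: (ler_kexp mk wS).
      - by apply: integZ; exact: integ_surv.
      - exact: integZ.
      - by move=> v vS; rewrite [leRHS]mulrC ih.
    rewrite (kexpZ mk wS)// [leRHS]mulrC; apply: ler_wpM2l.
      by rewrite addr_ge0.
    by apply: le_trans dV _; rewrite lerB.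
  have Ed : d * sv m.+1 w <= d by rewrite ler_piMr ?(ltW d0)// surv_le1.
  have VK : 0 <= U w `^ s * (d / K) by rewrite mulr_ge0// divr_ge0// ltW.
  have dd : 0 <= d * (m%:R * d / K) by rewrite mulr_ge0// ltW.
  have -> : m.+1%:R * d * sv m.+1 w = m%:R * d * sv m.+1 w + d * sv m.+1 w.
    by rewrite -natr1; ring.
  have -> : U w `^ s * (1 + m.+1%:R * d / K) =
     U w `^ s + U w `^ s * (m%:R * d / K) + U w `^ s * (d / K) by rewrite -natr1; ring.
  rewrite mulrBl !mulrDr !mulr1 in Es.
  lra.
have := claim N z zS.
have e1 : N%:R * d = eps * K.
  by rewrite /d mulrCA mulr_powRB1// ltW.
by rewrite e1 mulfK ?gt_eqF// -mulrA => /le_trans; apply; rewrite mulrC.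
Qed.

End Survival.

(** With h = t - s, concavity gives (k+1)^s - k^s <= k^(s-1), so the k-th term is at most M
    k^(-1-h). This is dominated by D (k^(-h) - (k+1)^(-h)), which telescopes. *)
Lemma telescoping_sum_bound (R : realType) (s t M : R) (v : nat -> R) :
  0 <= s -> s < t -> t <= 1 -> 0 <= M -> v 0%N <= 1 -> (forall n, 0 <= v n) ->
  (forall n, n%:R `^ t * v n <= M) ->
  forall N, \sum_(k < N) (k.+1%:R `^ s - k%:R `^ s) * v k <= 1 + 2 * M / (t - s).
Proof.
move=> s0 st t1 M0 v01 v0 vM.
pose h := t - s; have h0 : 0 < h by rewrite /h; lra.
have h1 : h <= 1 by rewrite /h; lra.
pose D := 2 * M / h.
have D0 : 0 <= D by rewrite divr_ge0 ?mulr_ge0// ltW.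
suff H N : \sum_(k < N.+1) (k.+1%:R `^ s - k%:R `^ s) * v k
    <= 1 + D * (1 - N.+1%:R `^ (- h)).
  case=> [|N]; first by rewrite big_ord0 addr_ge0.
  apply: le_trans (H N) _; rewrite lerD2l -/h -/D ler_piMr// gerBl.
elim: N => [|N ih].
  (* The term k = 0 escapes the power bounds and accounts for the summand 1. *)
  rewrite big_ord_recl big_ord0 addr0 !powR1 subrr mulr0 addr0.
  apply: (@le_trans _ _ (1 * v 0%N)); last by rewrite mul1r.
  by apply: ler_wpM2r => //; rewrite gerBl powR_ge0.
rewrite big_ord_recr/=; apply: le_trans (lerD ih (lexx _)) _.
rewrite -addrA lerD2l -lerBrDl -mulrBr [1 - _ - _]addrAC opprB subrKC.
set k : R := N.+1%:R; have k0 : 0 < k by rewrite ltr0n.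
have k1 : 1 <= k by rewrite ler1n.
have -> : N.+2%:R = k + 1 :> R by rewrite -natr1.
have kp : 0 < k + 1 by lra.
set y := v N.+1.
have y0 : 0 <= y by exact: v0.
have ky : k `^ t * y <= M by exact: vM.
have ks : 0 < k `^ s by exact: powR_gt0.
have up : (k + 1) `^ s - k `^ s <= k `^ s / k.
  have -> : k + 1 = k * (1 + k^-1) by field; rewrite gt_eqF.
  have ki : 0 <= k^-1 by rewrite invr_ge0 ltW.
  rewrite powRM ?(ltW k0)//; last by rewrite addr_ge0.
  rewrite -[X in _ - X]mulr1 -mulrBr; apply: ler_wpM2l; first exact: ltW.
  move: s0; rewrite le_eqVlt => /predU1P[<-|sp]; first by rewrite powRr0 subrr.
  have k10 : 0 <= 1 + k^-1 by rewrite addr_ge0.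
  have s1 : s <= 1 by lra.
  have := powR_concave1 sp s1 k10; rewrite addrAC subrr add0r lerBlDl => /le_trans; apply.
  by rewrite lerD2l ler_piMl.
(* Concavity of the power h at k / (k + 1) gives a loss h / (k + 1) >= h / (2 k); this is the 2 in
   [D]. *)
have low : k `^ (- h) * (h / (2 * k)) <= k `^ (- h) - (k + 1) `^ (- h).
  pose a := k / (k + 1).
  have -> : (k + 1) `^ (- h) = k `^ (- h) * a `^ h.
    rewrite /a powRM ?invr_ge0 ?(ltW k0) ?(ltW kp)// mulrA -powRD.
      by rewrite addNr powRr0 mul1r -powR_inv1 ?(ltW kp)// -powRrM mulN1r.
    by rewrite (gt_eqF k0) implybT.
  rewrite -[X in X - _]mulr1 -mulrBr; apply: ler_wpM2l; first exact: powR_ge0.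
  have a0 : 0 <= a by rewrite divr_ge0// ltW.
  have := powR_concave1 h0 h1 a0.
  have -> : h * (a - 1) = - (h / (k + 1)) by rewrite /a; field; rewrite gt_eqF.
  have : h / (2 * k) <= h / (k + 1).
    by rewrite ler_pM2l// lef_pV2 ?posrE ?mulr_gt0//; lra.
  by move: (h / (2 * k)) (h / (k + 1)) (a `^ h) => b1 b2 b3; lra.
apply: le_trans (ler_wpM2r y0 up) _.
apply: le_trans (ler_wpM2l D0 low).
have -> : k `^ s = k `^ t * k `^ (- h).
  rewrite -powRD; first by congr (_ `^ _); rewrite /h; ring.
  by rewrite (gt_eqF k0) implybT.
have -> : k `^ t * k `^ (- h) / k * y = (k `^ t * y) * (k `^ (- h) / k) by ring.
have -> : D * (k `^ (- h) * (h / (2 * k))) = M * (k `^ (- h) / k).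
  by rewrite /D; field; rewrite !gt_eqF.
by apply: ler_wpM2r => //; rewrite divr_ge0 ?powR_ge0// ltW.
Qed.

Section MomentsFromDrift.
Variables (R : realType) (S : finType) (Sig : set (R * S)).
Variables (P : R * S -> R * S -> R) (l eps : R) (U : R * S -> R).
Hypotheses (mk : markov_kernel Sig P) (U0 : forall w, 0 < U w) (eps0 : 0 < eps).

Let drift (t : R) := forall z, Sig z -> l < z.1 ->
  integ Sig P z (fun w => U w `^ t) /\
  kexp Sig P z (fun w => U w `^ t) <= U z `^ t - eps * U z `^ (t - 1).

(** With the clock started at 0, the weights of [surv_sum_bound] are the increments of (eps/s)^s
    k^s, so dividing by (eps/s)^s bounds the sum. *)
Lemma tau_moment_ge1 (s : R) z : 1 <= s -> drift s -> Sig z ->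
  (tau_moment Sig P l s z < +oo)%E.
Proof.
move=> s1 dr zS; have s0 : 0 < s by exact: lt_le_trans s1.
have es0 : 0 < eps / s by rewrite divr_gt0.
have e0 : 0 < (eps / s) `^ s by rewrite powR_gt0.
have sumM N : \sum_(k < N) (k.+1%:R `^ s - k%:R `^ s) * surv Sig P l k z
    <= U z `^ s / (eps / s) `^ s.
  rewrite ler_pdivlMr// mulrC mulr_sumr.
  have := surv_sum_bound mk U0 eps0 s1 dr N 0 zS.
  rewrite !mulr0 addr0 powR0 ?gt_eqF// add0r; apply: le_trans.
  rewrite le_eqVlt; apply/predU1P; left; apply: eq_bigr => k _.
  by rewrite add0n; move: (eps / s) es0 => d d0; rewrite !powRM ?ler0n ?(ltW d0)//; ring.
apply: (tau_moment_lty mk zS s0 sumM) => N; apply: le_trans (sumM N).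
(* Summation by parts shows that N^s P(tau > N) is at most the same sum. *)
have := sum_tau_prob Sig P l (fun k => k%:R `^ s) z N.
rewrite powR0 ?gt_eqF// add0r => <-; rewrite lerDr sumr_ge0// => k _.
by rewrite mulr_ge0 ?powR_ge0// tau_prob_ge0.
Qed.

Lemma tau_moment_lt1 (s t : R) z : 0 <= s -> s < t -> t <= 1 -> drift t -> Sig z ->
  (tau_moment Sig P l s z < +oo)%E.
Proof.
move=> s0 st t1 dr zS; have t0 : 0 < t by exact: le_lt_trans st.
have tail N : N%:R `^ t * surv Sig P l N z <= (1 + eps) * U z `^ t / eps.
  by rewrite ler_pdivlMr// mulrC (surv_tail_bound mk U0 eps0 t0 t1 dr).
have M0 : 0 <= (1 + eps) * U z `^ t / eps.
  by rewrite divr_ge0 ?mulr_ge0 ?powR_ge0 ?addr_ge0// ltW.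
apply: (tau_moment_lty mk zS t0 _ tail).
apply: (telescoping_sum_bound s0 st t1 M0 _ _ tail) => [|n].
  exact: (surv_le1 l mk 0 zS).
exact: surv_ge0.
Qed.

End MomentsFromDrift.

(** * Choice of the exponent and conclusion *)

Unset Implicit Arguments.

Theorem theorem2p3 (R : realType) (S : finType) (Sig : set (R * S))
  (P : R * S -> R * S -> R) (p Cp : R) (q : S -> S -> R) (pi : S -> R)
  (c s2 : S -> R) (theta : R) :
  (0 < #|S|)%N ->
  locally_finite_state_space Sig ->
  markov_kernel Sig P ->
  irreducible_chain Sig P ->
  lines_unbounded Sig ->
  2 < p ->
  (forall z, Sig z ->
     (\esum_(w in Sig) (P z w * `|w.1 - z.1| `^ p)%:E <= Cp%:E)%E) ->
  (forall i j (e : R), 0 < e -> exists M : R, forall x : R,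
     Sig (x, i) -> M <= x -> `|qx Sig P i j x - q i j| < e) ->
  stochastic q -> irreducible_matrix q -> stationary_distribution q pi ->
  (forall i, 0 <= s2 i) -> (exists i, s2 i != 0) ->
  (forall i (e : R), 0 < e -> exists M : R, forall x : R,
     Sig (x, i) -> M <= x -> `|x * mu Sig P i x - c i| < e) ->
  (forall i (e : R), 0 < e -> exists M : R, forall x : R,
     Sig (x, i) -> M <= x -> `|sigma2 Sig P i x - s2 i| < e) ->
  0 < theta ->
  \sum_i (2 * c i + (2 * theta - 1) * s2 i) * pi i < 0 ->
  forall s : R, 0 <= s -> s <= Num.min theta (p / 2) ->
  exists x0 : R, forall x : R, x0 <= x ->
    forall z, Sig z -> (tau_moment Sig P x s z < +oo)%E.
Proof.
move=> _ _ mk _ _ p2 mom hq sq iq stq s20 _ hc hs th0 neg s s0.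
rewrite le_min => /andP[sth sp].
set a := \sum_i _ in neg; pose b := \sum_i s2 i * pi i.
have b0 : 0 <= b by apply: sumr_ge0 => i _; rewrite mulr_ge0//; case: stq.
(* The drift condition is affine in the exponent with slope 2 b >= 0: smaller exponents keep it, and
   strictness allows slightly larger ones. *)
have condE t : \sum_i (2 * c i + (2 * t - 1) * s2 i) * pi i = a + 2 * (t - theta) * b.
  rewrite /a /b mulr_sumr -big_split/=; apply: eq_bigr => i _; ring.
have drift t : 0 < t -> 2 * t <= p -> a + 2 * (t - theta) * b < 0 ->
    exists (B : S -> R) (eps x0 : R), [/\ 0 < eps, (forall i, 1 <= B i) &
    forall z, Sig z -> x0 <= z.1 ->
      integ Sig P z (fun w => (w.1 ^+ 2 + B w.2) `^ t) /\
      kexp Sig P z (fun w => (w.1 ^+ 2 + B w.2) `^ t) <=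
        (z.1 ^+ 2 + B z.2) `^ t - eps * (z.1 ^+ 2 + B z.2) `^ (t - 1)].
  move=> t0 tp; rewrite -condE => ct.
  exact: lyapunov_drift mk p2 mom hq sq iq stq s20 hc hs t0 tp ct.
have U0 (B : S -> R) : (forall i, 1 <= B i) -> forall w : R * S, 0 < w.1 ^+ 2 + B w.2.
  by move=> B1 w; rewrite ltr_wpDl ?sqr_ge0// (lt_le_trans ltr01).
have [s1|s1] := leP 1 s.
  have st : a + 2 * (s - theta) * b < 0.
    by rewrite (le_lt_trans _ neg)// gerDl mulr_le0_ge0//; lra.
  have [||B [eps [x0 [e0 B1 dr]]]] := drift s _ _ st; [lra|lra|].
  exists x0 => x x0x z zS; apply: (tau_moment_ge1 mk (U0 B B1) e0 s1 _ zS).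
  by move=> v vS xv; apply: dr => //; rewrite (le_trans x0x)// ltW.
(* Raising theta by [eta] adds 2 eta b <= - a / 2, so the condition stays negative. *)
pose eta := - a / (4 * (b + 1)).
have b10 : 0 < b + 1 by lra.
have eta0 : 0 < eta by rewrite divr_gt0 ?mulr_gt0 ?ltr0n//; lra.
have etab : 4 * eta * (b + 1) = - a by rewrite /eta; field; rewrite gt_eqF.
(* The midpoint of s and 1 keeps s < t < 1, hence 2 t < 2 < p; the other bound keeps the drift
   condition even if s = theta. *)
pose t := Num.min (theta + eta) ((1 + s) / 2).
have t_le1 : t <= (1 + s) / 2 by rewrite /t ge_min lexx orbT.
have t_le2 : t <= theta + eta by rewrite /t ge_min lexx.
have st : s < t by rewrite /t lt_min; apply/andP; split; lra.
have ct : a + 2 * (t - theta) * b < 0.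
  have h : (t - theta) * b <= eta * b by apply: ler_wpM2r => //; lra.
  have : 0 <= eta * b by rewrite mulr_ge0// ltW.
  rewrite mulrDr mulr1 in etab; lra.
have [||B [eps [x0 [e0 B1 dr]]]] := drift t _ _ ct; [lra|lra|].
have t1 : t <= 1 by lra.
exists x0 => x x0x z zS; apply: (tau_moment_lt1 mk (U0 B B1) e0 s0 st t1 _ zS).
by move=> v vS xv; apply: dr => //; rewrite (le_trans x0x)// ltW.
Qed.
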